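(* Let $m\ge 1$ and $r$ be integers with $\frac{m-1}{2}\le r<m$, and let $U^*(r,m)$ be the encoding circuit of $\mathrm{pQRM}(r,m)$ on $n=2^m-1$ qubits built by the recursive construction described in the context (from $U^*(r,m-1)\otimes U(r,m-1)$ if $r<m-1$, and from $U^*(r-1,r)$ and $U^c(r-1,r)$ if $m=r+1$). Then: (i) The number of CNOT gates in the construction of $U^*(r,m)$ is $$\zeta^*(r,m)=\begin{cases}\sum_{i=m-r-1}^{r}\binom{m-1}{i}+\zeta^*(r,m-1)+\zeta(r,m-1)& \text{if } r<m-1,\\ 2^r+\zeta^*(r-1,r)+\zeta^c(r-1,r)&\text{if } m=r+1,\ m>1,\\ 0&\text{if } m=1,\end{cases}$$ where $\zeta(r,m)$ and $\zeta^c(r,m)$, the numbers of CNOT gates in the circuits $U(r,m)$ and $U^c(r,m)$, are given by $\zeta(m,m)=\zeta^c(m,m)=m2^{m-1}$, $\zeta(r,m)=\sum_{i=m-r-1}^{r}\binom{m-1}{i}+2\zeta(r,m-1)$ for $\frac{m-1}2\le r<m$, and $\zeta^c(r,m)=\sum_{i=0}^{r}\binom{m-1}{i}+2\zeta^c(r,m-1)$ for $0\le r<m$. (ii) The encoder $U^*(r,r+1)$ has depth $3r$ (after moving the single CNOT gate of step (d) of its construction, at each level of the recursion, to an earlier place in the circuit, before the computational-basis encoder that acts on the second half inside $U^*(r-1,r)$), and the encoding circuit $U^*(r,m)$ has depth $O(m+2r)=O(\log n)$.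
   Context: **Codes.** For $0\le r\le m$, $\mathrm{RM}(r,m)\subseteq\mathbb F_2^{2^m}$ is the binary Reed-Muller code: the set of evaluation vectors $\mathrm{Eval}^{(m)}(f)=(f(\boldsymbol\rho(1)),\dots,f(\boldsymbol\rho(2^m)))$ of polynomials $f\in\mathbb F_2[x_1,\dots,x_m]$ of degree at most $r$, where $\boldsymbol\rho(j)$ is the $m$-bit binary representation of $j-1$ (first coordinate most significant). $G(r,m)$ is its generator matrix whose rows are the evaluation vectors of the monomials of degree at most $r$ (no rows if $r<0$). Vectors of length $2^m$ are written as pairs of vectors of length $2^{m-1}$; the rows of $G(r,m)$ are the $(\mathbf u,\mathbf u)$ with $\mathbf u$ a row of $G(r,m-1)$ and the $(\mathbf 0,\mathbf v)$ with $\mathbf v$ a row of $G(r-1,m-1)$. A star denotes deletion of the first coordinate (or first column). $\mathbf 1$ is the all-ones vector. $\mathrm{pRM}(r,m)=\{\mathbf c^*:\mathbf c\in\mathrm{RM}(r,m)\}$ for $r\le m-1$; $\mathrm{pRM}(r,m)^\perp$ is spanned by the punctured evaluation vectors of monomials of degree between $1$ and $m-r-1$. $\mathrm{QRM}(r,m)$, $r\ge(m-1)/2$, is the CSS code with basis codewords $|\mathbf w\rangle_{r,m}\propto\sum_{\mathbf c\in\mathrm{RM}(m-r-1,m)}|\mathbf w\oplus\mathbf c\rangle$, $\mathbf w\in\mathrm{RM}(r,m)$. $\mathrm{pQRM}(r,m)$, $(m-1)/2\le r<m$, is the CSS code on $2^m-1$ qubits with basis codewords $|\mathbf w\rangle^*_{r,m}=|\mathrm{pRM}(r,m)^\perp|^{-1/2}\sum_{\mathbf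 c\in\mathrm{pRM}(r,m)^\perp}|\mathbf w\oplus\mathbf c\rangle$, $\mathbf w\in\mathrm{pRM}(r,m)$. **Conventions for circuits.** $A\setminus B$ is the matrix of rows of $A$ that are not rows of $B$. If $G$ has rows $\mathbf g_1,\mathbf g_2,\dots$, its row index map is $M[\mathbf g_i]=i$; the message qubit at position $M[\mathbf g]$ controls whether $\mathbf g$ is added to the encoded word. $P(p)$ moves the qubit at position $i$ to position $p(i)$; only the values of $p$ listed are prescribed, and $p$ is completed to a bijection. Permutations are relabelings of qubits. $\mathrm{CNOT}(i\to j)$ has control $i$ and target $j$. Depth is the number of layers of gates acting on disjoint qubits. **$U^c(r,m)$** ($0\le r\le m$; computational-basis encoder for $G(r,m)$; index map $M$ of $G(r,m)$). $U^c(0,0)$ is the identity on one qubit. For $m\ge1$ put $r'=\min(r,m-1)$ and let $M_1$ be the index map of $U^c(r',m-1)$. Apply $P(p)$ with $p(M[(\mathbf u,\mathbf u)])=M_1[\mathbf u]$ for rows $\mathbf u$ of $G(r',m-1)$ and $p(M[(\mathbf 0,\mathbf v)])=2^{m-1}+M_1[\mathbf v]$ for rows $\mathbf v$ of $G(r-1,m-1)$; then $\mathrm{CNOT}(M_1[\mathbf u]\to 2^{m-1}+M_1[\mathbf u])$ for all rows $\mathbf u$ of $G(r',m-1)$; then $U^c(r',m-1)^{\otimes2}$. **$U(r,m)$** ($\frac{m-1}2\le r\le m$; encoder of $\mathrm{QRM}(r,m)$). $U(m,m)=U^c(m,m)$. For $r<m$ let $M$ be the index map of the matrix whose rows are those of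 $G(r,m)\setminus G(m-r-1,m)$ followed by $(\mathbf g,\mathbf g)$ for $\mathbf g$ in $G(m-r-1,m-1)\setminus G(m-r-2,m-1)$, and $M_1$ that of $U(r,m-1)$. Apply Hadamard gates on qubits $k+1,\dots,k+\binom{m-1}{m-r-1}$, $k=\sum_{i=m-r}^r\binom mi$; then $P(p)$ with $p(M[(\mathbf u,\mathbf u)])=M_1[\mathbf u]$ for $\mathbf u\in G_3=G(r,m-1)\setminus G(m-r-2,m-1)$ and $p(M[(\mathbf 0,\mathbf v)])=2^{m-1}+M_1[\mathbf v]$ for $\mathbf v\in G(r-1,m-1)\setminus G(m-r-2,m-1)$; then $\mathrm{CNOT}(M_1[\mathbf u]\to2^{m-1}+M_1[\mathbf u])$ for $\mathbf u\in G_3$; then $U(r,m-1)^{\otimes 2}$. **$U^*(r,m)$, case $m>r+1$.** Let $M$ be the index map of the matrix whose rows are the punctured rows of $(G(r,m)\setminus G(m-r-1,m))\cup\{\mathbf 1\}$ followed by $(\mathbf g^*,\mathbf g)$ for $\mathbf g$ in $G(m-r-1,m-1)\setminus G(m-r-2,m-1)$; let $M_1,M_2$ be the index maps of $U^*(r,m-1)$ and $U(r,m-1)$. Apply Hadamard gates on qubits $k+1,\dots,k+\binom{m-1}{m-r-1}$, $k=1+\sum_{i=m-r}^r\binom mi$; then $P(p)$ with $p(M[(\mathbf u^*,\mathbf u)])=M_1[\mathbf u^*]$ for $\mathbf u\in (G(r,m-1)\setminus G(m-r-2,m-1))\cup\{\mathbf 1\}$ and $p(M[(\mathbf 0,\mathbf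 v)])=2^{m-1}-1+M_2[\mathbf v]$ for $\mathbf v\in G(r-1,m-1)\setminus G(m-r-2,m-1)$; then $\mathrm{CNOT}(M_1[\mathbf u^*]\to2^{m-1}-1+M_2[\mathbf u])$ for $\mathbf u\in G(r,m-1)\setminus G(m-r-2,m-1)$; then $U^*(r,m-1)\otimes U(r,m-1)$. **$U^*(r,r+1)$.** $U^*(0,1)$ is the identity on one qubit. For $r\ge1$ let $M$ be the index map of $G(r,r+1)^*$, and $M_1,M_2$ those of $U^*(r-1,r)$ and $U^c(r-1,r)$. (a) Apply $P(p)$ with $p(M[(\mathbf u^*,\mathbf u)])=M_1[\mathbf u^*]$ and $p(M[(\mathbf 0,\mathbf v)])=2^r-1+M_2[\mathbf v]$ for rows $\mathbf u,\mathbf v$ of $G(r-1,r)$, and $p(M[(\mathbf u^*,\mathbf u)])=2^{r+1}-1$ for $\mathbf u=00\cdots01$. (b) Apply $\mathrm{CNOT}(M_1[\mathbf u^*]\to2^r-1+M_2[\mathbf u])$ for all rows $\mathbf u$ of $G(r-1,r)$. (c) Apply $U^*(r-1,r)$ on the first $2^r-1$ qubits. (d) Apply $\mathrm{CNOT}(2^{r+1}-1\to2^r-1)$. (e) Apply $U^c(r-1,r)$ on the last $2^r$ qubits. *)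

(* Defs.v *)
From HB Require Import structures.
From mathcomp Require Import all_boot all_order all_algebra.
Set Implicit Arguments. Unset Strict Implicit. Unset Printing Implicit Defensive.
Import Order.TTheory GRing.Theory Num.Theory.

(* Qubit positions and row indices are numbered from 0 throughout, so that     *)
(* position i of a one-based description is position i - 1 here.               *)

(** ** Circuits *)

Inductive gate := Had of nat | Cnot of nat & nat.   (* Cnot control target *)

(* [Relabel p] moves the qubit at position i to position p i. *)
Inductive op := Gate of gate | Relabel of (nat -> nat).

Definition circuit := seq op.

Definition qubits (g : gate) : seq nat :=
  match g with Had i => [:: i] | Cnot i j => [:: i; j] end.

Definition map_gate (f : nat -> nat) (g : gate) : gate :=
  match g with Had i => Had (f i) | Cnot i j => Cnot (f i) (f j) end.

(* The circuit c on n qubits, acting on positions off, ..., off + n - 1. *)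
Definition embed_op (off n : nat) (o : op) : op :=
  match o with
  | Gate g => Gate (map_gate (addn off) g)
  | Relabel p =>
      Relabel (fun i => if off <= i < off + n then off + p (i - off) else i)
  end.

Definition embed (off n : nat) (c : circuit) : circuit := map (embed_op off n) c.

Definition tensor (n1 n2 : nat) (c1 c2 : circuit) : circuit :=
  embed 0 n1 c1 ++ embed n1 n2 c2.

Definition is_cnot (o : op) : bool :=
  if o is Gate (Cnot _ _) then true else false.

Definition cnot_count (c : circuit) : nat := count is_cnot c.

(** *** Depth *)

(* Position, at the end of c, of the qubit that is at position i at its start. *)
Fixpoint track (c : circuit) (i : nat) : nat :=
  match c with
  | [::] => i
  | Gate _ :: c' => track c' i
  | Relabel p :: c' => track c' (p i)
  end.

(* The gates of c in order, each qubit being named by its position at the end  *)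
(* of c. Relabelings disappear: they are not gates and take no time.           *)
Fixpoint wire_gates (c : circuit) : seq gate :=
  match c with
  | [::] => [::]
  | Gate g :: c' => map_gate (track c') g :: wire_gates c'
  | Relabel _ :: c' => wire_gates c'
  end.

Definition overlap (g h : gate) : bool := has (mem (qubits g)) (qubits h).

(* The k-th gate of gs is put in layer l k < d. Gates of one layer act on      *)
(* disjoint qubits, and gates sharing a qubit are executed in the order of gs. *)
Definition layering (gs : seq gate) (d : nat) (l : nat -> nat) : Prop :=
  (forall k, k < size gs -> l k < d) /\
  (forall j k, j < k < size gs ->
     overlap (nth (Had 0) gs j) (nth (Had 0) gs k) -> l j < l k).

Definition has_depth (c : circuit) (d : nat) : Prop :=
  (exists l, layering (wire_gates c) d l) /\
  (forall d' l, layering (wire_gates c) d' l -> d <= d').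

(** *** Action on state vectors *)

Section Semantics.
Variables (C : numClosedFieldType) (n : nat).

Definition state := n.-tuple bool -> C.   (* amplitudes in the standard basis *)

Definition set_bit (x : n.-tuple bool) (i : nat) (b : bool) : n.-tuple bool :=
  [tuple if val k == i then b else tnth x k | k < n].

Definition act (psi : state) (o : op) : state := fun x =>
  match o with
  | Gate (Had i) =>
      ((\sum_(b : bool) (-1) ^+ (b && nth false x i) * psi (set_bit x i b))
        / sqrtC 2)%R
  | Gate (Cnot i j) => psi (set_bit x j (nth false x j (+) nth false x i))
  | Relabel p => psi [tuple nth false x (p k) | k < n]
  end.

Definition run (c : circuit) (psi : state) : state := foldl act psi c.

End Semantics.

(** ** Reed-Muller generator matrices *)

(* A binary vector, and a matrix given by its rows. The pair (u, v) is u ++ v, *)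
(* puncturing is [behead].                                                     *)
Definition bitvec := seq 'F_2.
Definition bitmat := seq bitvec.

(* i-th bit of the m-bit binary representation of j, i = 0 being the most      *)
(* significant one.                                                            *)
Definition rho (m j : nat) (i : 'I_m) : 'F_2 := ((j %/ 2 ^ (m - i.+1))%:R)%R.

(* Evaluation vector of the monomial \prod_(i in S) x_i. *)
Definition eval_monomial (m : nat) (S : {set 'I_m}) : bitvec :=
  [seq (\prod_(i in S) rho j i)%R | j <- iota 0 (2 ^ m)].

(* The degree bound is an integer: there are no rows when r < 0. *)
Definition monomial_rows (r : int) (m : nat) : bitmat :=
  [seq eval_monomial T | T in [pred T : {set 'I_m} | (#|T|%:Z <= r)%R]].

Definition ones (m : nat) : bitvec := nseq (2 ^ m) 1%R.
Definition zeros (n : nat) : bitvec := nseq n 0%R.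

(* The last unit vector 00...01 of length n. *)
Definition unit_last (n : nat) : bitvec := rcons (zeros n.-1) 1%R.

Definition rows_minus (A B : bitmat) : bitmat := [seq g <- A | g \notin B].

Definition puncture (A : bitmat) : bitmat := map behead A.

(** ** The recursive constructions *)

(* What the constructions leave open: the order of the rows of G(r, m) and of  *)
(* (G(r, m) \ G(m-r-1, m)) U {1}, and the permutations used in the first stage *)
(* of U^c(r, m), U(r, m) and U^*(r, m). The constraints that they have to      *)
(* satisfy are gathered in [admissible] below.                                 *)
Record layout := Layout {
  G : int -> nat -> bitmat;
  G1 : nat -> nat -> bitmat;
  pc : nat -> nat -> nat -> nat;
  pU : nat -> nat -> nat -> nat;
  pS : nat -> nat -> nat -> nat
}.

Section Construction.
Variable L : layout.

Notation "''G' ( r , m )" := (G L r%R m) (at level 8, format "''G' ( r ,  m )").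

(* G(r, m) \ G(m-r-1, m), the rows of degree m-r, ..., r. *)
Definition D (r m : nat) : bitmat :=
  rows_minus 'G(r%:Z, m) 'G(m%:Z - r%:Z - 1, m).

(* G(m-r-1, m-1) \ G(m-r-2, m-1) *)
Definition Hrows (r m : nat) : bitmat :=
  rows_minus 'G(m%:Z - r%:Z - 1, m.-1) 'G(m%:Z - r%:Z - 2, m.-1).

(* G(r, m-1) \ G(m-r-2, m-1) *)
Definition G3 (r m : nat) : bitmat :=
  rows_minus 'G(r%:Z, m.-1) 'G(m%:Z - r%:Z - 2, m.-1).

(* G(r-1, m-1) \ G(m-r-2, m-1) *)
Definition G4 (r m : nat) : bitmat :=
  rows_minus 'G(r%:Z - 1, m.-1) 'G(m%:Z - r%:Z - 2, m.-1).

(* The matrices whose row index maps describe the message qubits of U^c(r, m), *)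
(* U(r, m) and U^*(r, m).                                                      *)
Definition matc (r m : nat) : bitmat := 'G(r%:Z, m).

Definition matU (r m : nat) : bitmat :=
  if m <= r then matc m m else D r m ++ [seq g ++ g | g <- Hrows r m].

Definition matS (r m : nat) : bitmat :=
  if r.+1 < m
  then puncture (G1 L r m) ++ [seq behead g ++ g | g <- Hrows r m]
  else puncture 'G(r%:Z, m).

Definition Mc (r m : nat) (g : bitvec) : nat := index g (matc r m).
Definition MU (r m : nat) (g : bitvec) : nat := index g (matU r m).
Definition MS (r m : nat) (g : bitvec) : nat := index g (matS r m).

Definition had_layer (k l : nat) : circuit := [seq Gate (Had i) | i <- iota k l].

Fixpoint Uc (r m : nat) : circuit :=
  if m is m'.+1 then
    let r' := minn r m' in
    Relabel (pc L r m)
      :: [seq Gate (Cnot (Mc r' m' u) (2 ^ m' + Mc r' m' u)) | u <- 'G(r'%:Z, m')]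
      ++ tensor (2 ^ m') (2 ^ m') (Uc r' m') (Uc r' m')
  else [::].

Fixpoint U (r m : nat) : circuit :=
  if m <= r then Uc m m else
  if m is m'.+1 then
    had_layer (\sum_(m - r <= i < r.+1) 'C(m, i)) 'C(m', m - r.+1)
      ++ Relabel (pU L r m)
      :: [seq Gate (Cnot (MU r m' u) (2 ^ m' + MU r m' u)) | u <- G3 r m]
      ++ tensor (2 ^ m') (2 ^ m') (U r m') (U r m')
  else [::].

(* First stage of U^*(r, m): Hadamard gates (if r + 1 < m), relabeling and     *)
(* CNOT gates from the first 2^(m-1) - 1 qubits to the last 2^(m-1) ones.      *)
Definition Ustar_first (r m : nat) : circuit :=
  let m' := m.-1 in
  if r < m' then
    had_layer (1 + \sum_(m - r <= i < r.+1) 'C(m, i)) 'C(m', m - r.+1)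
      ++ Relabel (pS L r m)
      :: [seq Gate (Cnot (MS r m' (behead u)) (2 ^ m' - 1 + MU r m' u))
         | u <- G3 r m]
  else
    Relabel (pS L r m)
      :: [seq Gate (Cnot (MS r.-1 m' (behead u)) (2 ^ m' - 1 + Mc r.-1 m' u))
         | u <- 'G(r%:Z - 1, m')].

(* U^*(r, m) for r < m; the last case is m = r + 1 > 1, so that m' = r. *)
Fixpoint Ustar (r m : nat) : circuit :=
  if m is m'.+1 then
    if m' == 0 then [::]
    else if r < m' then
      Ustar_first r m ++ tensor (2 ^ m' - 1) (2 ^ m') (Ustar r m') (U r m')
    else
      Ustar_first r m
        ++ embed 0 (2 ^ m' - 1) (Ustar r.-1 m')
        ++ [:: Gate (Cnot (2 ^ m - 2) (2 ^ m' - 2))]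
        ++ embed (2 ^ m' - 1) (2 ^ m') (Uc r.-1 m')
  else [::].

(* U^*(r, m) with the CNOT gate of step (d) of each U^*(s, s+1) moved inside   *)
(* the copy of U^*(s-1, s) that precedes it, to just before the encoder        *)
(* U^c(s-2, s-1) with which this copy ends. The circuit is given as a pair     *)
(* (front, back), to be run in this order, where for m = r + 1 > 1 the back    *)
(* part is the final U^c(r-1, r). The target of the moved gate is named by     *)
(* its position w before the relabelings of the encoder that it jumps over.    *)
Fixpoint Ustar_split (r m : nat) : circuit * circuit :=
  if m is m'.+1 then
    if m' == 0 then ([::], [::])
    else if r < m' then
      let: (front, back) := Ustar_split r m' in
      (Ustar_first r m ++ tensor (2 ^ m' - 1) (2 ^ m') (front ++ back) (U r m'),
       [::])
    else
      let: (front, back) := Ustar_split r.-1 m' in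
      let w := index (2 ^ m' - 2) (mkseq (track back) (2 ^ m' - 1)) in
      (Ustar_first r m
         ++ embed 0 (2 ^ m' - 1) front
         ++ [:: Gate (Cnot (2 ^ m - 2) w)]
         ++ embed 0 (2 ^ m' - 1) back,
       embed (2 ^ m' - 1) (2 ^ m') (Uc r.-1 m'))
  else ([::], [::]).

Definition Ustar_moved (r m : nat) : circuit :=
  (Ustar_split r m).1 ++ (Ustar_split r m).2.

(** *** Constraints on the row orders and on the permutations *)

Definition permutes (n : nat) (p : nat -> nat) : Prop :=
  (forall i, i < n -> p i < n) /\ {in gtn n &, injective p}.

Definition pc_spec (r m : nat) : Prop :=
  let m' := m.-1 in let r' := minn r m' in
  [/\ permutes (2 ^ m) (pc L r m),
      {in 'G(r'%:Z, m'), forall u,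
         pc L r m (Mc r m (u ++ u)) = Mc r' m' u}
    & {in 'G(r%:Z - 1, m'), forall v,
         pc L r m (Mc r m (zeros (2 ^ m') ++ v)) = 2 ^ m' + Mc r' m' v}].

Definition pU_spec (r m : nat) : Prop :=
  let m' := m.-1 in
  [/\ permutes (2 ^ m) (pU L r m),
      {in G3 r m, forall u,
         pU L r m (MU r m (u ++ u)) = MU r m' u}
    & {in G4 r m, forall v,
         pU L r m (MU r m (zeros (2 ^ m') ++ v)) = 2 ^ m' + MU r m' v}].

(* Case m > r + 1. *)
Definition pS_spec (r m : nat) : Prop :=
  let m' := m.-1 in
  [/\ permutes (2 ^ m - 1) (pS L r m),
      {in ones m' :: G3 r m, forall u,
         pS L r m (MS r m (behead u ++ u)) = MS r m' (behead u)}
    & {in G4 r m, forall v,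
         pS L r m (MS r m (zeros (2 ^ m' - 1) ++ v)) = 2 ^ m' - 1 + MU r m' v}].

(* Case m = r + 1. *)
Definition pS_last_spec (r : nat) : Prop :=
  let m := r.+1 in
  [/\ permutes (2 ^ m - 1) (pS L r m),
      {in 'G(r%:Z - 1, r), forall u,
         pS L r m (MS r m (behead u ++ u)) = MS r.-1 r (behead u)},
      {in 'G(r%:Z - 1, r), forall v,
         pS L r m (MS r m (zeros (2 ^ r - 1) ++ v)) = 2 ^ r - 1 + Mc r.-1 r v}
    & let u := unit_last (2 ^ r) in
      pS L r m (MS r m (behead u ++ u)) = 2 ^ m - 2].

Definition admissible : Prop :=
  (forall r m, perm_eq 'G(r, m) (monomial_rows r m)) /\
  (forall r m, m.-1 <= 2 * r -> r.+1 < m ->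
     perm_eq (G1 L r m) (ones m :: D r m)) /\
  (forall r m, 0 < m -> r <= m -> pc_spec r m) /\
  (forall r m, 0 < m -> m.-1 <= 2 * r -> r < m -> pU_spec r m) /\
  (forall r m, m.-1 <= 2 * r -> r.+1 < m -> pS_spec r m) /\
  (forall r, 0 < r -> pS_last_spec r).

End Construction.

(** ** The numbers of CNOT gates *)

Fixpoint zetac (r m : nat) : nat :=
  if m is m'.+1 then
    if r < m then \sum_(0 <= i < r.+1) 'C(m', i) + 2 * zetac r m'
    else m * 2 ^ m'
  else 0.

Fixpoint zeta (r m : nat) : nat :=
  if m is m'.+1 then
    if r < m then \sum_(m - r.+1 <= i < r.+1) 'C(m', i) + 2 * zeta r m'
    else m * 2 ^ m'
  else 0.

Fixpoint zetas (r m : nat) : nat :=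
  if m is m'.+1 then
    if m' == 0 then 0
    else if r < m' then
      \sum_(m - r.+1 <= i < r.+1) 'C(m', i) + zetas r m' + zeta r m'
    else 2 ^ r + zetas r.-1 m' + zetac r.-1 m'
  else 0.

(* Main.v *)
(** In U^c the last qubit of a block lies in the second half of every sub-block that contains it,
    so it is only ever a target of CNOT gates; this is why the gate of step (d), whose target it is,
    can jump over the preceding encoder U^c.  Among the messages of U^c(s-1, s) only the frozen
    position 2^s - 1 is left for the wire that ends there, so the jumping gate hits exactly the
    control of the previous jumping gate.  Hence the r first stages, the r moved gates and the r
    layers of the last U^c(r-1, r) form a chain of length 3r.  Conversely, the U^c of level i only
    needs to wait for the moved gate of level i + 1, and the schedule that starts it right after that
    gate has 3r layers. *)

From HB Require Import structures.
Require Import Defs.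
From mathcomp Require Import all_boot all_order all_algebra zify.
From Stdlib Require Import FunctionalExtensionality Classical.
Set Implicit Arguments. Unset Strict Implicit. Unset Printing Implicit Defensive.
Import Order.TTheory GRing.Theory Num.Theory.

(** * Monomial evaluation vectors *)

(** The row orders and the permutations are known only through [admissible], so arguments about
    wires cannot compute positions: they rest on the injectivity of the index maps and on counting
    rows. The decisive count is that [G(r, r+1)] has exactly as many rows as the punctured block has
    qubits. Every qubit of that block is then a control of the first stage, and a chain of gates can
    always be prolonged to the left. Since a wire is named by its position at the end of the
    circuit, appending a circuit renames all earlier gates by a permutation. Schedules and chains
    survive because an injective renaming preserves overlaps. Neither depth bound is inductive as it
    stands. The upper one carries along that the gates of the front touching the second half are
    over before layer [2 * r]; the lower one carries a chain of length [2 * r] that is left open on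
    the last wire. *)

Lemma map_const_nseq (T U : Type) (x : U) (s : seq T) :
  [seq x | _ <- s] = nseq (size s) x.
Proof. by elim: s => //= _ s ->. Qed.

Definition tail_set m (S : {set 'I_m.+1}) : {set 'I_m} :=
  [set i | lift ord0 i \in S].

Lemma prod_tail_set (R : comNzRingType) m (S : {set 'I_m.+1}) (F : 'I_m.+1 -> R) :
  (\prod_(i in S) F i =
   (if ord0 \in S then F ord0 else 1) * \prod_(i in tail_set S) F (lift ord0 i))%R.
Proof.
rewrite big_mkcond big_ord_recl; congr (_ * _)%R.
by rewrite [RHS]big_mkcond; apply: eq_bigr => i _; rewrite inE.
Qed.

Lemma card_tail_set m (S : {set 'I_m.+1}) :
  #|S| = (ord0 \in S) + #|tail_set S|.
Proof.
rewrite -2!sum1_card big_mkcond big_ord_recl; congr (_ + _).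
by rewrite [RHS]big_mkcond; apply: eq_bigr => i _; rewrite inE.
Qed.

Lemma tail_set_inj m (S T : {set 'I_m.+1}) :
  (ord0 \in S) = (ord0 \in T) -> tail_set S = tail_set T -> S = T.
Proof.
move=> h0 hST; apply/setP => i; case: (unliftP ord0 i) => [j ->|-> //].
by move/setP/(_ j): hST; rewrite !inE.
Qed.

Lemma natr_F2 n : (n%:R = (odd n)%:R :> 'F_2)%R.
Proof.
rewrite -{1}[n]odd_double_half natrD -muln2 natrM.
by rewrite (_ : 2%:R = 0 :> 'F_2)%R ?mulr0 ?addr0 //; apply/val_inj.
Qed.

(** The first variable is the most significant bit, hence 0 on the first half of the points and 1 on
    the second, while the other bits repeat. This is the splitting of the rows into [(u, u)] and
    [(0, v)]. *)
Lemma eval_monomial_rec m (S : {set 'I_m.+1}) :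
  eval_monomial S =
    (if ord0 \in S then zeros (2 ^ m) else eval_monomial (tail_set S))
      ++ eval_monomial (tail_set S).
Proof.
have rho0 j : j < 2 ^ m -> rho j (@ord0 m) = 0%R /\ rho (2 ^ m + j) (@ord0 m) = 1%R.
  move=> hj; rewrite /rho subn1 /= divn_small // divnDl ?dvdnn //.
  by rewrite divnn expn_gt0 /= divn_small // addn0.
have rhoS j (i : 'I_m) : rho j (lift ord0 i) = rho j i.
  by rewrite /rho lift0 subSS.
(* A bit is a quotient read modulo 2; the shift by [2 ^ m] adds the even number [2 ^ i.+1] to it. *)
have rhoA j (i : 'I_m) : rho (2 ^ m + j) i = rho j i.
  rewrite /rho; have e : 2 ^ m = 2 ^ i.+1 * 2 ^ (m - i.+1).
    by rewrite -expnD subnKC.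
  rewrite e divnMDl ?expn_gt0 // natrD natr_F2 oddX /=.
  by rewrite (_ : 0%:R = 0)%R ?add0r.
have prodE j : (\prod_(i in S) rho j i = (if ord0 \in S then rho j (@ord0 m) else 1)
    * \prod_(i in tail_set S) rho j i)%R.
  by rewrite prod_tail_set; congr (_ * _)%R; apply: eq_bigr => i _.
rewrite {1}/eval_monomial expnS mul2n -addnn iotaD map_cat add0n; congr cat.
  case: ifP => h0; last first.
    by apply: eq_map => j; rewrite prodE h0 mul1r.
  rewrite /zeros -[in RHS](size_iota 0 (2 ^ m)) -map_const_nseq.
  apply/eq_in_map => j; rewrite mem_iota add0n => /andP[_ hj].
  by rewrite prodE h0 (proj1 (rho0 _ hj)) mul0r.
rewrite -[X in iota X _]addn0 iotaDl -map_comp.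
apply/eq_in_map => j; rewrite mem_iota add0n => /andP[_ hj] /=.
rewrite prodE (proj2 (rho0 _ hj)) if_same mul1r.
by apply: eq_bigr => i _; rewrite rhoA.
Qed.

Lemma size_eval_monomial m (S : {set 'I_m}) : size (eval_monomial S) = 2 ^ m.
Proof. by rewrite size_map size_iota. Qed.

Lemma eval_monomial0 (S : {set 'I_0}) : eval_monomial S = [:: 1%R].
Proof. by rewrite /eval_monomial /= big1 // => -[]. Qed.

(** At the last point all variables are 1. Puncturing keeps this entry, so it separates monomials
    from the zero vector in the punctured setting too. *)
Lemma last_eval_monomial x m (S : {set 'I_m}) : last x (eval_monomial S) = 1%R.
Proof.
elim: m x S => [|m IH] x S; first by rewrite eval_monomial0.
by rewrite eval_monomial_rec last_cat.
Qed.

Lemma size_zeros n : size (zeros n) = n.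
Proof. exact: size_nseq. Qed.

Lemma last_zeros n : last 0%R (zeros n) = 0%R.
Proof. by elim: n. Qed.

Lemma eval_monomial_neq0 m (S : {set 'I_m}) : eval_monomial S <> zeros (2 ^ m).
Proof.
by move=> /(congr1 (last 0%R)); rewrite last_eval_monomial last_zeros => /eqP.
Qed.

Lemma eval_monomial_inj m : injective (@eval_monomial m).
Proof.
elim: m => [|m IH] S T; first by move=> _; apply/setP => -[].
rewrite !eval_monomial_rec => /eqP; rewrite eqseq_cat; last first.
  by do 2!case: ifP => _; rewrite ?size_nseq ?size_eval_monomial.
case/andP => /eqP h /eqP/IH hST; apply: tail_set_inj => //.
move: h; case: (ord0 \in S); case: (ord0 \in T) => //.
  by move/esym/eval_monomial_neq0.
by move/eval_monomial_neq0.
Qed.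

Lemma last_behead (T : Type) (x : T) s : 1 < size s -> last x (behead s) = last x s.
Proof. by case: s => [|a [|b s]]. Qed.

Lemma behead_cat (T : Type) (s t : seq T) : 0 < size s -> behead (s ++ t) = behead s ++ t.
Proof. by case: s. Qed.

(* Fails for m = 1, where both monomials evaluate to 1 at the only remaining point. *)
Lemma puncture_eval_inj m : 1 < m -> injective (fun S : {set 'I_m} => behead (eval_monomial S)).
Proof.
case: m => [|[|m]] // _ S T.
have h2 : 1 < 2 ^ m.+1 by rewrite expnS; have := expn_gt0 2 m; lia.
rewrite (eval_monomial_rec S) (eval_monomial_rec T) !behead_cat; try by case: ifP => _;
  rewrite ?size_nseq ?size_eval_monomial ?expn_gt0.
move=> /eqP; rewrite eqseq_cat; last first.
  by rewrite !size_behead; do 2!case: ifP => _; rewrite ?size_nseq ?size_eval_monomial.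
case/andP => /eqP h /eqP/eval_monomial_inj hST; apply: tail_set_inj => //.
have aux (U : {set 'I_m.+1}) : behead (eval_monomial U) <> behead (zeros (2 ^ m.+1)).
  move/(congr1 (last 0%R)).
  rewrite (last_behead _ (s := zeros _)) ?size_zeros // last_behead ?size_eval_monomial //.
  by rewrite last_eval_monomial last_zeros => /eqP.
move: h; case: (ord0 \in S); case: (ord0 \in T) => //; first by move/esym/aux.
by move/aux.
Qed.

(** The product of all variables is 1 only at the last point: the unit vector of step (a) is the row
    of full degree. *)
Lemma eval_monomialT m : eval_monomial [set: 'I_m] = unit_last (2 ^ m).
Proof.
elim: m => [|m IH]; first by rewrite eval_monomial0.
rewrite eval_monomial_rec inE (_ : tail_set _ = setT) ?IH; last first.
  by apply/setP => i; rewrite !inE.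
rewrite /unit_last -rcons_cat /zeros -nseqD; congr (rcons (nseq _ _) _).
by rewrite expnS; have := expn_gt0 2 m; lia.
Qed.

Lemma eval_monomial_set0 m : eval_monomial (set0 : {set 'I_m}) = ones m.
Proof.
rewrite /ones -[in RHS](size_iota 0 (2 ^ m)) -map_const_nseq.
by apply: eq_map => j; rewrite big_set0.
Qed.

Lemma mem_monomial_rows (r : int) m g :
  reflect (exists2 S : {set 'I_m}, (#|S|%:Z <= r)%R & g = eval_monomial S)
          (g \in monomial_rows r m).
Proof.
apply: (iffP imageP) => [[S]|[S h ->]]; first by rewrite inE; exists S.
by exists S.
Qed.

Lemma mem_monomial_rows_eval (r : int) m (S : {set 'I_m}) :
  (eval_monomial S \in monomial_rows r m) = (#|S|%:Z <= r)%R.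
Proof.
apply/mem_monomial_rows/idP => [[T h /eval_monomial_inj ->]//|h].
by exists S.
Qed.

Lemma uniq_monomial_rows r m : uniq (monomial_rows r m).
Proof. by rewrite map_inj_uniq ?enum_uniq //; apply: eval_monomial_inj. Qed.

Lemma card_sets_between m a b :
  #|[pred T : {set 'I_m} | a <= #|T| < b]| = \sum_(a <= i < b) 'C(m, i).
Proof.
rewrite -sum1_card big_mkcond /=.
under [RHS]eq_bigr => i _.
  rewrite -{1}(card_ord m) -card_draws -sum1_card big_mkcond /=; over.
rewrite exchange_big /=; apply: eq_bigr => T _; rewrite -big_mkcond sum1_count.
rewrite (eq_count (a2 := pred1 #|T|)); last by move=> i; rewrite !inE eq_sym.
by rewrite count_uniq_mem ?iota_uniq // mem_index_iota inE; case: ifP.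
Qed.

Lemma size_monomial_rows_full m : size (monomial_rows m%:Z m) = 2 ^ m.
Proof.
rewrite size_map -cardE -[in RHS](card_ord m) -cardsT -card_powerset.
by apply: eq_card => S; rewrite !inE subsetT lez_nat (leq_trans (max_card _)) ?card_ord.
Qed.

Lemma size_monomial_rows_pred m : size (monomial_rows m%:Z m.+1) = 2 ^ m.+1 - 1.
Proof.
rewrite size_map -cardE subn1 -[in RHS](card_ord m.+1) -cardsT -card_powerset.
have -> : powerset [set: 'I_m.+1] = [set: {set 'I_m.+1}].
  by apply/setP => S; rewrite !inE subsetT.
rewrite cardsT -(cardC1 [set: 'I_m.+1]); apply: eq_card => S.
rewrite !inE lez_nat -ltnS -[X in _ < X](card_ord m.+1) -[X in _ < X]cardsT.
by rewrite -properT properEcard subsetT.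
Qed.

(** * Circuits, wires and schedules *)

Definition gate_code (g : gate) : nat * option nat :=
  match g with Had i => (i, None) | Cnot i j => (i, Some j) end.

Definition gate_decode (c : nat * option nat) : gate :=
  match c with (i, None) => Had i | (i, Some j) => Cnot i j end.

Lemma gate_codeK : cancel gate_code gate_decode. Proof. by case. Qed.

HB.instance Definition _ := Equality.copy gate (can_type gate_codeK).

Lemma qubits_map f g : qubits (map_gate f g) = map f (qubits g).
Proof. by case: g. Qed.

Lemma map_gate_id g : map_gate id g = g. Proof. by case: g. Qed.

Lemma map_gate_comp f h g : map_gate f (map_gate h g) = map_gate (f \o h) g.
Proof. by case: g. Qed.

Lemma eq_map_gate f h g : {in qubits g, f =1 h} -> map_gate f g = map_gate h g.
Proof. by case: g => [i|i j] e /=; rewrite !e ?inE ?eqxx ?orbT. Qed.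

Lemma overlapP g h : reflect (exists2 i, i \in qubits g & i \in qubits h) (overlap g h).
Proof. by apply: (iffP hasP) => [[i h1 h2]|[i h1 h2]]; exists i. Qed.

Lemma overlap_map f g h : overlap g h -> overlap (map_gate f g) (map_gate f h).
Proof.
by case/overlapP => i gi hi; apply/overlapP; exists (f i); rewrite qubits_map map_f.
Qed.

Arguments overlapP {g h}.

Definition inside (a b : nat) (g : gate) : bool := all (fun i => a <= i < b) (qubits g).

Lemma insideP a b g : reflect {in qubits g, forall i, a <= i < b} (inside a b g).
Proof. exact: allP. Qed.
Arguments insideP {a b g}.

Lemma overlap_inside a b a' b' g h :
  inside a b g -> inside a' b' h -> b <= a' -> overlap g h = false.
Proof.
move=> /insideP hg /insideP hh hb; apply/overlapP => -[i /hg h1 /hh h2]; lia.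
Qed.

Lemma overlap_map_inj n f g h : {in gtn n &, injective f} ->
  inside 0 n g -> inside 0 n h -> overlap (map_gate f g) (map_gate f h) = overlap g h.
Proof.
move=> finj /insideP hg /insideP hh; apply/overlapP/overlapP; last first.
  by move=> [i gi hi]; exists (f i); rewrite qubits_map map_f.
rewrite !qubits_map => -[_ /mapP[i gi ->] /mapP[j hj e]].
exists i => //; rewrite (finj i j) //; rewrite inE.
- by case/andP: (hg _ gi).
- by case/andP: (hh _ hj).
Qed.

(** [permutes] asks for an injection of the positions below [n] into themselves; finiteness does the
    rest. This is how the starting position of a given wire is found. *)
Lemma permutes_surj n p : permutes n p -> forall j, j < n -> exists2 i, i < n & p i = j.
Proof.
move=> [hlt hinj] j hj.
have inj : injective (fun i : 'I_n => Ordinal (hlt i (ltn_ord i))).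
  by move=> a b /(congr1 val) /= /hinj e; apply/val_inj/e; rewrite inE.
have /codomP[i /(congr1 val) /= ->] := inj_card_onto inj (leqnn _) (Ordinal hj).
by exists i.
Qed.

Definition embed_perm off n (p : nat -> nat) i :=
  if off <= i < off + n then off + p (i - off) else i.

Lemma permutes_embed off n N p : off + n <= N -> permutes n p ->
  permutes N (embed_perm off n p).
Proof.
rewrite /embed_perm => hN [hlt hinj]; split => [i hi|i j].
  by case: ifP => // /andP[h1 h2]; have := hlt (i - off); lia.
rewrite !inE => hi hj; case: ifP => hi'; case: ifP => hj' //.
- move=> e; have : i - off = j - off by apply: hinj; rewrite ?inE; lia.
  by lia.
- by have := hlt (i - off); lia.
- by have := hlt (j - off); lia.
Qed.

Definition wf_op n (o : op) : Prop :=
  match o with Gate g => inside 0 n g | Relabel p => permutes n p end.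

Fixpoint wf n (c : circuit) : Prop := if c is o :: c' then wf_op n o /\ wf n c' else True.

Lemma wf_cat n c1 c2 : wf n (c1 ++ c2) <-> wf n c1 /\ wf n c2.
Proof. by elim: c1 => [|o c1 IH] /=; tauto. Qed.

Lemma wf_gates n (gs : seq gate) : wf n (map Gate gs) <-> all (inside 0 n) gs.
Proof.
elim: gs => //= g gs IH; split; first by case=> -> /IH ->.
by case/andP => -> /IH.
Qed.

Lemma wf_embed off n N c : off + n <= N -> wf n c -> wf N (embed off n c).
Proof.
move=> hN; elim: c => //= -[g|p] c IH [h1 /IH h2]; split => //=.
  by apply/insideP => i; rewrite qubits_map => /mapP[j /(insideP h1) hj ->]; lia.
exact: permutes_embed.
Qed.

Lemma wf_tensor n1 n2 N c1 c2 : n1 + n2 <= N -> wf n1 c1 -> wf n2 c2 ->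
  wf N (tensor n1 n2 c1 c2).
Proof. by move=> h w1 w2; apply/wf_cat; split; apply: wf_embed => //; lia. Qed.

Lemma embed_cat off n c1 c2 : embed off n (c1 ++ c2) = embed off n c1 ++ embed off n c2.
Proof. exact: map_cat. Qed.

Lemma embed_embed a n b k c : b + k <= n ->
  embed a n (embed b k c) = embed (a + b) k c.
Proof.
move=> hk; rewrite /embed -map_comp; apply: eq_map => -[g|p] /=.
  by rewrite map_gate_comp; congr Gate; apply: eq_map_gate => i _ /=; lia.
congr Relabel; apply: functional_extensionality => i /=.
case: ifP => h1; first (case: ifP => h2); case: ifP => h3; try lia.
by rewrite -addnA; congr (_ + (_ + p _)); lia.
Qed.

Lemma track_cat c1 c2 i : track (c1 ++ c2) i = track c2 (track c1 i).
Proof. by elim: c1 i => //= -[g|p] c1 IH i /=. Qed.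

Lemma track_gates gs i : track (map Gate gs) i = i.
Proof. by elim: gs. Qed.

Lemma track_embed off n c : wf n c -> track (embed off n c) =1 embed_perm off n (track c).
Proof.
rewrite /embed_perm; elim: c => [|[g|p] c IH] /= => [_ i|[_ /IH]|[[hlt _] /IH e] i] //.
  by case: ifP; lia.
rewrite e; case: (boolP (off <= i < off + n)) => hi; last by rewrite (negbTE hi).
have hp := hlt (i - off); rewrite ifT; last by lia.
by congr (_ + track _ _); lia.
Qed.

Lemma permutes_track n c : wf n c -> permutes n (track c).
Proof.
elim: c => [_|[g|p] c IH] /=; first by split.
  by case=> _ /IH.
move=> [[hlt hinj] /IH [tlt tinj]]; split => [i hi|i j hi hj e]; first exact/tlt/hlt.
by apply: hinj => //; apply: tinj => //; apply: hlt.
Qed.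

(** Wires are named by their final position, so what follows renames the earlier gates by
    [track c2]. *)
Lemma wire_gates_cat c1 c2 :
  wire_gates (c1 ++ c2) = map (map_gate (track c2)) (wire_gates c1) ++ wire_gates c2.
Proof.
elim: c1 => //= -[g|p] c1 IH //=; rewrite IH map_gate_comp; congr cons.
by apply: eq_map_gate => i _ /=; rewrite track_cat.
Qed.

Lemma wire_gates_gates gs : wire_gates (map Gate gs) = gs.
Proof.
elim: gs => //= g gs ->; congr cons; rewrite -[RHS]map_gate_id.
by apply: eq_map_gate => i _; rewrite track_gates.
Qed.

Lemma wire_gates_inside n c : wf n c -> all (inside 0 n) (wire_gates c).
Proof.
elim: c => //= -[g|p] c IH /= [h1 h2]; rewrite ?IH // andbT.
have [tlt _] := permutes_track h2.
by apply/insideP => i; rewrite qubits_map => /mapP[j /(insideP h1) hj ->]; apply/tlt; lia.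
Qed.

Lemma wire_gates_embed off n c : wf n c ->
  wire_gates (embed off n c) = map (map_gate (addn off)) (wire_gates c).
Proof.
elim: c => //= -[g|p] c IH /= [h1 h2]; rewrite IH //; congr cons.
rewrite !map_gate_comp; apply: eq_map_gate => i /(insideP h1) hi /=.
by rewrite track_embed // /embed_perm ifT ?addKn //; lia.
Qed.

Lemma wire_gates_embed0 n c : wf n c -> wire_gates (embed 0 n c) = wire_gates c.
Proof.
move=> h; rewrite wire_gates_embed // -[RHS]map_id; apply: eq_map => g.
by rewrite -[RHS]map_gate_id; apply: eq_map_gate.
Qed.

Lemma wire_gates_embed_inside off n c : wf n c ->
  all (inside off (off + n)) (wire_gates (embed off n c)).
Proof.
move=> h; rewrite wire_gates_embed // all_map; apply: sub_all (wire_gates_inside h) => g.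
by move=> /insideP hg; apply/insideP => i; rewrite qubits_map => /mapP[j /hg hj ->]; lia.
Qed.

Lemma map_gate_track_id a b gs c : {in [pred i | a <= i < b], track c =1 id} ->
  all (inside a b) gs -> map (map_gate (track c)) gs = gs.
Proof.
move=> hc; elim: gs => //= g gs IH /andP[/insideP hg /IH ->]; congr cons.
by rewrite -[RHS]map_gate_id; apply: eq_map_gate => i /hg; apply: hc.
Qed.

Lemma wire_gates_tensor n1 n2 c1 c2 : wf n1 c1 -> wf n2 c2 ->
  wire_gates (tensor n1 n2 c1 c2) = wire_gates c1 ++ map (map_gate (addn n1)) (wire_gates c2).
Proof.
move=> h1 h2; rewrite wire_gates_cat wire_gates_embed0 // wire_gates_embed //.
congr cat; apply: map_gate_track_id (wire_gates_inside h1) => i; rewrite inE => hi.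
by rewrite track_embed // /embed_perm ifF //; lia.
Qed.

Lemma track_tensor n1 n2 c1 c2 i : wf n1 c1 -> wf n2 c2 ->
  track (tensor n1 n2 c1 c2) i =
    if i < n1 then track c1 i else if i < n1 + n2 then n1 + track c2 (i - n1) else i.
Proof.
move=> h1 h2; rewrite track_cat !track_embed // /embed_perm subn0.
have [lt1 _] := permutes_track h1.
case: (ltnP i n1) => hi /=; last by rewrite hi.
by rewrite ifF //; have := lt1 _ hi; lia.
Qed.

(** * Schedules: lists of gates with their layers *)

Definition compat (a b : gate * nat) : bool := overlap a.1 b.1 ==> (a.2 < b.2).

Definition delay k (ts : seq (gate * nat)) := [seq (t.1, k + t.2) | t <- ts].

Definition move_gates f (ts : seq (gate * nat)) := [seq (map_gate f t.1, t.2) | t <- ts].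

(** Schedules are lists of gates paired with layers rather than functions on positions: such lists
    can be concatenated, shifted in time and renamed. *)
Definition layerable (gs : seq gate) d := exists ts,
  [/\ unzip1 ts = gs, all (fun t => t.2 < d) ts & pairwise compat ts].

Lemma layering_schedule gs d l : layering gs d l ->
  let ts := zip gs (mkseq l (size gs)) in
  [/\ unzip1 ts = gs, all (fun t => t.2 < d) ts & pairwise compat ts].
Proof.
move=> [hd hl] ts; have hs : size gs = size (mkseq l (size gs)) by rewrite size_mkseq.
have szts : size ts = size gs by rewrite size_zip -hs minnn.
split; first by rewrite unzip1_zip // -hs.
  apply/(all_nthP (Had 0, 0)) => k; rewrite szts => hk.
  by rewrite nth_zip //= nth_mkseq // hd.
apply/(pairwiseP (Had 0, 0)) => j k; rewrite !inE szts => hj hk hjk.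
rewrite !nth_zip // /compat /= !nth_mkseq //; apply/implyP => ho.
by apply: hl => //; rewrite hjk.
Qed.

Lemma layerableP gs d : layerable gs d <-> exists l, layering gs d l.
Proof.
split; last by case=> l /layering_schedule h; eexists; exact: h.
case=> ts [<- hd hc]; exists (fun k => (nth (Had 0, 0) ts k).2).
split => [k|j k]; rewrite size_map => hk; first exact: (all_nthP _ hd).
have [hjk hk'] := andP hk; have hj' := ltn_trans hjk hk'.
rewrite !(nth_map (Had 0, 0)) // => ho.
by have /implyP := pairwiseP (Had 0, 0) hc j k hj' hk' hjk; apply.
Qed.

Lemma has_depthP c d : layerable (wire_gates c) d ->
  (forall d', layerable (wire_gates c) d' -> d <= d') -> has_depth c d.
Proof.
move=> h1 h2; split; first exact/layerableP.
by move=> d' l h; apply/h2/layerableP; exists l.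
Qed.

(** Descent on [d], where excluded middle decides whether a shorter schedule exists. To bound a
    depth from above it is then enough to exhibit one schedule. *)
Lemma layerable_has_depth c d : layerable (wire_gates c) d ->
  exists2 d', has_depth c d' & d' <= d.
Proof.
elim/ltn_ind: d => d IH h.
case: (classic (exists2 d', d' < d & layerable (wire_gates c) d')).
  case=> d' hd /(IH _ hd)[e he hed]; exists e => //; exact: leq_trans hed (ltnW hd).
move=> hn; exists d => //; apply: has_depthP => // d' hd'.
by case: leqP => // hlt; case: hn; exists d'.
Qed.

(* Consecutive gates of a chain share a qubit, so that they lie in increasing layers. *)
Lemma chain_leq_depth cs gs d : subseq cs gs -> sorted overlap cs ->
  layerable gs d -> size cs <= d.
Proof.
move=> /subseqP[b hb ->] hs [ts [e hd hc]]; subst gs.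
rewrite -map_mask in hs *; set us := mask b ts in hs *.
have hu : pairwise compat us by apply: subseq_pairwise hc; apply: mask_subseq.
have hdu : all (fun t => t.2 < d) us by apply/allP => t /mem_mask /(allP hd).
have : sorted ltn (unzip2 us).
  rewrite sorted_map in hs *; have := pairwise_sorted hu.
  case: (us) hs => //= u s; elim: s u => //= v s IH u /andP[h1 h2] /andP[h3 h4].
  by rewrite (IH v) // andbT; apply: (implyP h3).
move/(sorted_uniq ltn_trans ltnn) => hU.
rewrite size_map -(size_map snd) -(size_iota 0 d); apply: uniq_leq_size hU _.
by move=> _ /mapP[t /(allP hdu) h ->]; rewrite mem_iota.
Qed.

Lemma layerable_nil : layerable [::] 0.
Proof. by exists [::]. Qed.

Lemma layerable_le gs d d' : d <= d' -> layerable gs d -> layerable gs d'.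
Proof.
move=> h [ts [h1 h2 h3]]; exists ts; split => //.
by apply: sub_all h2 => t /leq_trans; apply.
Qed.

Lemma pairwise_move n f ts : {in gtn n &, injective f} -> all (inside 0 n) (unzip1 ts) ->
  pairwise compat (move_gates f ts) = pairwise compat ts.
Proof.
move=> finj; rewrite all_map => /allP hin; rewrite pairwise_map; apply: eq_in_pairwise (allss _).
by move=> s t /hin hs /hin ht; rewrite /compat /= (overlap_map_inj finj).
Qed.

Lemma pairwise_delay k ts : pairwise compat (delay k ts) = pairwise compat ts.
Proof. by rewrite pairwise_map; apply: eq_pairwise => s t; rewrite /compat /= ltn_add2l. Qed.

Lemma unzip1_move f ts : unzip1 (move_gates f ts) = map (map_gate f) (unzip1 ts).
Proof. by rewrite /unzip1 -!map_comp. Qed.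

Lemma unzip1_delay k ts : unzip1 (delay k ts) = unzip1 ts.
Proof. by rewrite /unzip1 -map_comp. Qed.

Lemma unzip1_cat (ts us : seq (gate * nat)) : unzip1 (ts ++ us) = unzip1 ts ++ unzip1 us.
Proof. exact: map_cat. Qed.

Definition disjoint_gates (gs : seq gate) := pairwise (fun g h => ~~ overlap g h) gs.

Definition at_start (gs : seq gate) := [seq (g, 0) | g <- gs].

Lemma pairwise_at_start gs : disjoint_gates gs -> pairwise compat (at_start gs).
Proof. by rewrite pairwise_map; apply: sub_pairwise => g h /=; rewrite /compat => /negbTE ->. Qed.

Lemma unzip1_at_start gs : unzip1 (at_start gs) = gs.
Proof. by rewrite /unzip1 -map_comp map_id. Qed.

Lemma disjoint_gates_map n f gs : {in gtn n &, injective f} -> all (inside 0 n) gs ->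
  disjoint_gates (map (map_gate f) gs) = disjoint_gates gs.
Proof.
move=> finj /allP hin; rewrite /disjoint_gates pairwise_map; apply: eq_in_pairwise (allss _).
by move=> s t /hin hs /hin ht /=; rewrite (overlap_map_inj finj).
Qed.

Lemma layerable_map n f gs d : {in gtn n &, injective f} -> all (inside 0 n) gs ->
  layerable gs d -> layerable (map (map_gate f) gs) d.
Proof.
move=> finj hin [ts [e hd hc]]; exists (move_gates f ts).
rewrite unzip1_move e; split => //; last by rewrite (pairwise_move finj) ?e.
by rewrite all_map.
Qed.

(** The layer takes slot 0 and the rest is delayed by 1. Its gates stay disjoint after renaming
    because [track c] is injective below [n]. *)
Lemma layerable_layer n gs c d : all (inside 0 n) gs -> disjoint_gates gs -> wf n c ->
  layerable (wire_gates c) d -> layerable (wire_gates (map Gate gs ++ c)) d.+1.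
Proof.
move=> hin hdis hwf [ts [e hd hc]]; rewrite wire_gates_cat wire_gates_gates.
have [_ tinj] := permutes_track hwf.
exists (at_start (map (map_gate (track c)) gs) ++ delay 1 ts); split.
- by rewrite unzip1_cat unzip1_at_start unzip1_delay e.
- rewrite all_cat !all_map /=; apply/andP; split; first exact/allP.
  by apply: sub_all hd => t /=.
rewrite pairwise_cat pairwise_delay hc pairwise_at_start ?(disjoint_gates_map tinj) //.
rewrite !andbT; apply/allrelP => _ _ /mapP[g _ ->] /mapP[t _ ->].
by rewrite /compat /= implybT.
Qed.

Lemma layerable_tensor n1 n2 c1 c2 d : wf n1 c1 -> wf n2 c2 ->
  layerable (wire_gates c1) d -> layerable (wire_gates c2) d ->
  layerable (wire_gates (tensor n1 n2 c1 c2)) d.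
Proof.
move=> w1 w2 [t1 [e1 d1 p1]] [t2 [e2 d2 p2]]; rewrite wire_gates_tensor //.
have inj : {in gtn n2 &, injective (addn n1)} by move=> i j _ _ /addnI.
exists (t1 ++ move_gates (addn n1) t2); split.
- by rewrite unzip1_cat unzip1_move e1 e2.
- by rewrite all_cat d1 all_map.
rewrite pairwise_cat p1 (pairwise_move inj) ?p2 ?e2 ?wire_gates_inside //.
rewrite !andbT; apply/allrelP => s _ hs /mapP[t ht ->].
rewrite /compat /= (overlap_inside (a := 0) (b := n1) (a' := n1) (b' := n1 + n2)) //.
  by have /allP := wire_gates_inside w1; apply; rewrite -e1; apply: map_f.
apply/insideP => i; rewrite qubits_map => /mapP[j hj ->].
have /allP/(_ t.1) := wire_gates_inside w2; rewrite -e2 map_f // => /(_ isT) /insideP /(_ _ hj).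
by lia.
Qed.

(** * Rows, index maps and gate layers *)

Definition cnot_gates (T : Type) (f h : T -> nat) (A : seq T) := [seq Cnot (f u) (h u) | u <- A].

Lemma cnot_gatesE (T : Type) (f h : T -> nat) (A : seq T) :
  [seq Gate (Cnot (f u) (h u)) | u <- A] = map Gate (cnot_gates f h A).
Proof. by rewrite /cnot_gates -map_comp. Qed.

Lemma cnot_gates_inside (T : eqType) (f h : T -> nat) (A : seq T) n :
  {in A, forall u, f u < n} -> {in A, forall u, h u < n} -> all (inside 0 n) (cnot_gates f h A).
Proof.
move=> hf hh; rewrite all_map; apply/allP => u hu; apply/insideP => i /=.
by rewrite !inE => /orP[] /eqP ->; [apply: hf | apply: hh].
Qed.

Lemma cnot_gates_disjoint (T : eqType) (f h : T -> nat) (A : seq T) b :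
  uniq A -> {in A &, injective f} -> {in A &, injective h} ->
  {in A, forall u, f u < b} -> {in A, forall u, b <= h u} ->
  disjoint_gates (cnot_gates f h A).
Proof.
move=> uA finj hinj hf hh; rewrite /disjoint_gates pairwise_map.
rewrite uniq_pairwise in uA; apply: (sub_in_pairwise _ (allss A)) uA => u v hu hv huv /=.
have fu := hf _ hu; have fv := hf _ hv; have gu := hh _ hu; have gv := hh _ hv.
apply/negP => /overlapP[i]; rewrite !inE => /orP[] /eqP -> /orP[] /eqP; try lia.
- by move=> /(finj _ _ hu hv) e; move: huv; rewrite e /= eqxx.
- by move=> /(hinj _ _ hu hv) e; move: huv; rewrite e /= eqxx.
Qed.

Lemma had_layer_inside k l n : k + l <= n -> all (inside 0 n) [seq Had i | i <- iota k l].
Proof.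
move=> h; rewrite all_map; apply/allP => i; rewrite mem_iota => hi.
by apply/insideP => j; rewrite /= inE => /eqP ->; lia.
Qed.

Lemma had_layer_disjoint k l : disjoint_gates [seq Had i | i <- iota k l].
Proof.
rewrite /disjoint_gates pairwise_map; have := iota_uniq k l; rewrite uniq_pairwise.
apply: sub_pairwise => i j /= hij; apply/negP => /overlapP[x]; rewrite !inE => /eqP ->.
exact/negP.
Qed.

Lemma had_layerE k l : had_layer k l = map Gate [seq Had i | i <- iota k l].
Proof. by rewrite -map_comp. Qed.

Lemma cnot_count_cat c1 c2 : cnot_count (c1 ++ c2) = cnot_count c1 + cnot_count c2.
Proof. exact: count_cat. Qed.

Lemma cnot_count_embed off n c : cnot_count (embed off n c) = cnot_count c.
Proof. by rewrite /cnot_count count_map; apply: eq_count => -[[]|]. Qed.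

Lemma cnot_count_tensor n1 n2 c1 c2 :
  cnot_count (tensor n1 n2 c1 c2) = cnot_count c1 + cnot_count c2.
Proof. by rewrite cnot_count_cat !cnot_count_embed. Qed.

Lemma cnot_count_had_layer k l : cnot_count (had_layer k l) = 0.
Proof. by rewrite /cnot_count count_map (eq_count (a2 := pred0)) ?count_pred0. Qed.

Lemma cnot_count_cnots (T : Type) (f h : T -> nat) A :
  cnot_count [seq Gate (Cnot (f u) (h u)) | u <- A] = size A.
Proof. by rewrite /cnot_count count_map (eq_count (a2 := predT)) ?count_predT. Qed.

Lemma cnot_count_relabel p c : cnot_count (Relabel p :: c) = cnot_count c.
Proof. by []. Qed.

Lemma sum_binomial_le m a b : \sum_(a <= i < b) 'C(m, i) <= 2 ^ m.
Proof.
rewrite -card_sets_between -[in X in _ <= X](card_ord m) -cardsT -card_powerset.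
by apply/subset_leq_card/subsetP => S _; rewrite powersetE subsetT.
Qed.

(** * Sets of rows and injectivity of the index maps *)

Section Layout.
Variables (L : layout) (adm : admissible L).

Lemma mem_G r m g : (g \in G L r m) = (g \in monomial_rows r m).
Proof. by case: adm => h _; apply: perm_mem. Qed.

Lemma GP r m g : reflect (exists2 S : {set 'I_m}, (#|S|%:Z <= r)%R & g = eval_monomial S)
  (g \in G L r m).
Proof. by rewrite mem_G; apply: mem_monomial_rows. Qed.

Lemma mem_G_eval r m (S : {set 'I_m}) : (eval_monomial S \in G L r m) = (#|S|%:Z <= r)%R.
Proof. by rewrite mem_G mem_monomial_rows_eval. Qed.

Lemma uniq_G r m : uniq (G L r m).
Proof. by case: adm => h _; rewrite (perm_uniq (h r m)) uniq_monomial_rows. Qed.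

Lemma size_G r m : size (G L r m) = size (monomial_rows r m).
Proof. by case: adm => h _; rewrite (perm_size (h r m)). Qed.

Lemma size_G_full m : size (G L m%:Z m) = 2 ^ m.
Proof. by rewrite size_G size_monomial_rows_full. Qed.

Lemma size_G_pred m : size (G L m%:Z m.+1) = 2 ^ m.+1 - 1.
Proof. by rewrite size_G size_monomial_rows_pred. Qed.

Lemma size_G_sum (r m : nat) : size (G L r%:Z m) = \sum_(0 <= i < r.+1) 'C(m, i).
Proof.
rewrite size_G size_map -cardE -card_sets_between.
by apply: eq_card => S; rewrite !inE lez_nat.
Qed.

Lemma size_G_le r m : size (G L r m) <= 2 ^ m.
Proof.
rewrite -size_G_full; apply: uniq_leq_size (uniq_G _ _) _ => g /GP[S _ ->].
by rewrite mem_G_eval lez_nat (leq_trans (max_card _)) ?card_ord.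
Qed.

(** Both are the rows of degree m - r, ..., r: the rows coupled by the first stage at level m + 1
    are the free messages of level m. *)
Lemma D_G3 r m : D L r m = G3 L r m.+1.
Proof. by rewrite /D /G3 /=; congr (rows_minus _ (G L _ _)); lia. Qed.

Lemma degree_gap (k r m : nat) : r <= m ->
  ~~ (k%:Z <= m.+1%:Z - r%:Z - 2)%R = (m - r <= k).
Proof. lia. Qed.

Lemma G3P r m g : r <= m ->
  reflect (exists2 S : {set 'I_m}, m - r <= #|S| <= r & g = eval_monomial S) (g \in G3 L r m.+1).
Proof.
move=> hr; rewrite mem_filter /=; apply: (iffP andP).
  case=> h1 /GP[S h2 e]; exists S => //; move: h1 h2.
  by rewrite e mem_G_eval lez_nat degree_gap // => -> ->.
by case=> S h ->; rewrite !mem_G_eval degree_gap // lez_nat; apply/andP.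
Qed.

Lemma G3_sub r m : r <= m -> {subset G3 L r m.+1 <= G L r%:Z m}.
Proof. by move=> hr g /(G3P _ hr)[S h ->]; rewrite mem_G_eval lez_nat; case/andP: h. Qed.

Lemma uniq_G3 r m : uniq (G3 L r m).
Proof. exact/filter_uniq/uniq_G. Qed.

Lemma size_G3 r m : r <= m -> size (G3 L r m.+1) = \sum_(m - r <= i < r.+1) 'C(m, i).
Proof.
move=> hr; rewrite -card_sets_between.
have -> : size (G3 L r m.+1) =
    size [seq eval_monomial T | T in [pred T : {set 'I_m} | m - r <= #|T| < r.+1]].
  apply/perm_size/uniq_perm; first exact: uniq_G3.
    by rewrite map_inj_uniq ?enum_uniq //; apply: eval_monomial_inj.
  move=> g; apply/(G3P _ hr)/imageP => -[S hS ->]; exists S => //.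
by rewrite size_map -cardE.
Qed.

Lemma index_lt (T : eqType) (s : seq T) x n : x \in s -> size s <= n -> index x s < n.
Proof. by rewrite -index_mem => /leq_trans; apply. Qed.

(** A vector outside [s] has index [size s], so equality of the indices puts [y] in [s] along with
    [x]. *)
Lemma index_injl (T : eqType) (s : seq T) (x y : T) : x \in s -> index x s = index y s -> x = y.
Proof.
move=> hx e; have hy : y \in s by rewrite -index_mem -e index_mem.
by rewrite -(nth_index x hx) e nth_index.
Qed.

Lemma Mc_lt r m u : u \in G L r%:Z m -> Mc L r m u < 2 ^ m.
Proof. by move=> h; apply: index_lt h (size_G_le _ _). Qed.

Lemma Mc_inj r m : {in G L r%:Z m &, injective (Mc L r m)}.
Proof. by move=> u v hu _; apply: index_injl. Qed.

Lemma mem_matU r m u : r <= m -> u \in G3 L r m.+1 -> u \in matU L r m.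
Proof.
move=> hr hu; rewrite /matU; case: leqP => h; last by rewrite mem_cat D_G3 hu.
have -> : m = r by apply/eqP; rewrite eqn_leq h.
by rewrite /matc; have := G3_sub hr hu; have -> : r = m by apply/eqP; rewrite eqn_leq hr.
Qed.

Lemma MU_lt r m u : r <= m -> u \in G3 L r m.+1 -> MU L r m u < 2 ^ m.
Proof.
move=> hr hu; rewrite /MU /matU; case: (leqP m r) => h.
  have em : m = r by apply/eqP; rewrite eqn_leq h.
  by apply: Mc_lt; have := G3_sub hr hu; rewrite -em.
rewrite index_cat D_G3 hu; apply: index_lt hu _; rewrite size_G3 //.
exact: sum_binomial_le.
Qed.

Lemma MU_inj r m : r <= m -> {in G3 L r m.+1 &, injective (MU L r m)}.
Proof. by move=> hr u v /(mem_matU hr) hu _; apply: index_injl. Qed.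

Lemma behead_G_inj m r : {in G L r%:Z m.+2 &, injective (fun u : bitvec => behead u)}.
Proof. by move=> _ _ /GP[S _ ->] /GP[T _ ->] /puncture_eval_inj ->. Qed.

(* For r = 0 the only row is the all-ones vector. *)
Lemma behead_Glast_inj r : {in G L r%:Z r.+1 &, injective (fun u : bitvec => behead u)}.
Proof.
case: r => [|r]; last exact: behead_G_inj.
move=> _ _ /GP[S hS ->] /GP[T hT ->] _; move: hS hT.
by rewrite !lez_nat !leqn0 !cards_eq0 => /eqP -> /eqP ->.
Qed.

Lemma matS_last r : matS L r r.+1 = puncture (G L r%:Z r.+1).
Proof. by rewrite /matS ltnn. Qed.

Lemma MS_last_lt r u : u \in G L r%:Z r.+1 -> MS L r r.+1 (behead u) < 2 ^ r.+1 - 1.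
Proof.
move=> hu; rewrite /MS matS_last; apply: index_lt; first exact: map_f.
by rewrite size_map size_G_pred.
Qed.

Lemma MS_last_inj r : {in G L r%:Z r.+1 &, injective (fun u => MS L r r.+1 (behead u))}.
Proof.
move=> u v hu hv; rewrite /MS matS_last => /index_injl e.
by apply: (behead_Glast_inj hu hv); apply: e; apply: map_f.
Qed.

(** [G(r, r+1)] lacks only the row of full degree, so its punctured rows occupy every position of
    the block. *)
Lemma MS_last_surj r i : i < 2 ^ r.+1 - 1 ->
  exists2 u, u \in G L r%:Z r.+1 & MS L r r.+1 (behead u) = i.
Proof.
rewrite -size_G_pred => hi; exists (nth [::] (G L r%:Z r.+1) i); first exact: mem_nth.
rewrite /MS matS_last -(nth_map _ [::]) // index_uniq ?size_map //.
by rewrite map_inj_in_uniq ?uniq_G //; apply: behead_Glast_inj.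
Qed.

Lemma mem_matS r m u : m <= 2 * r -> r < m -> u \in G3 L r m.+1 -> behead u \in matS L r m.
Proof.
move=> hm hr hu; have hr' := ltnW hr.
rewrite /matS; case: ltnP => h; last first.
  exact/map_f/(G3_sub hr' hu).
case: adm => _ [/(_ r m) hG1 _]; rewrite mem_cat map_f //.
by rewrite (perm_mem (hG1 _ h)) ?inE ?D_G3 ?hu ?orbT //; lia.
Qed.

Lemma MS_lt r m u : m <= 2 * r -> r < m -> u \in G3 L r m.+1 ->
  MS L r m (behead u) < 2 ^ m - 1.
Proof.
move=> hm hr hu; have hr' := ltnW hr.
case: (ltnP r.+1 m) => h; last first.
  have em : m = r.+1 by lia.
  by subst m; apply: MS_last_lt; apply: G3_sub hu.
case: adm => _ [/(_ r m) hG1 _]; have {}hG1 := hG1 (ltac:(lia)) h.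
have hu1 : u \in G1 L r m by rewrite (perm_mem hG1) inE D_G3 hu orbT.
rewrite /MS /matS h index_cat map_f //; apply: index_lt; first exact: map_f.
rewrite size_map; case: m {hm} => [|m] in hr hu hr' h hG1 hu1 * => //.
(* There are as many punctured qubits as monomials not of full degree. The all-ones row and the rows
   of [D] are distinct ones among these, since the degrees in [D] are positive and at most [r]. *)
rewrite -size_G_pred (perm_size hG1); apply: uniq_leq_size.
  rewrite /= D_G3 uniq_G3 andbT -eval_monomial_set0; apply/(G3P _ hr') => -[S hS].
  by move/eval_monomial_inj => e; move: hS; rewrite -e cards0; lia.
move=> g; rewrite inE D_G3 => /orP[/eqP ->|/(G3P _ hr')[S hS ->]].
  by rewrite -eval_monomial_set0 mem_G_eval cards0.
by rewrite mem_G_eval; lia.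
Qed.

Lemma MS_inj r m : m <= 2 * r -> r < m ->
  {in G3 L r m.+1 &, injective (fun u => MS L r m (behead u))}.
Proof.
(* The two hypotheses force [m >= 2], where puncturing is injective on monomials. *)
case: m => [|[|m]] hm hr; [lia | lia |] => u v hu hv /(index_injl (mem_matS hm hr hu)).
by apply: behead_G_inj; apply: G3_sub (ltnW hr) _ _.
Qed.

End Layout.

(** * The encoders Uc and U *)

Section Encoders.
Variables (L : layout) (adm : admissible L).

Lemma admissible_pc r m : 0 < m -> r <= m -> pc_spec L r m.
Proof. by case: adm => _ [_ [h _]]; apply: h. Qed.

Lemma admissible_pU r m : 0 < m -> m.-1 <= 2 * r -> r < m -> pU_spec L r m.
Proof. by case: adm => _ [_ [_ [h _]]]; apply: h. Qed.

Lemma admissible_pS r m : m.-1 <= 2 * r -> r.+1 < m -> pS_spec L r m.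
Proof. by case: adm => _ [_ [_ [_ [h _]]]]; apply: h. Qed.

Lemma admissible_pS_last r : 0 < r -> pS_last_spec L r.
Proof. by case: adm => _ [_ [_ [_ [_ h]]]]; apply: h. Qed.

Definition Uc_layer r m :=
  cnot_gates (Mc L r m) (fun u => 2 ^ m + Mc L r m u) (G L r%:Z m).

Lemma UcS r m : Uc L r m.+1 = Relabel (pc L r m.+1) :: map Gate (Uc_layer (minn r m) m)
  ++ tensor (2 ^ m) (2 ^ m) (Uc L (minn r m) m) (Uc L (minn r m) m).
Proof. by rewrite -cnot_gatesE. Qed.

Definition U_layer r m :=
  cnot_gates (MU L r m) (fun u => 2 ^ m + MU L r m u) (G3 L r m.+1).

Lemma U_le r m : m <= r -> U L r m = Uc L m m.
Proof. by case: m => // m h; rewrite /U h. Qed.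

Lemma U_gt r m : r <= m -> U L r m.+1 =
  map Gate [seq Had i | i <- iota (\sum_(m.+1 - r <= i < r.+1) 'C(m.+1, i)) 'C(m, m.+1 - r.+1)]
    ++ Relabel (pU L r m.+1) :: map Gate (U_layer r m)
    ++ tensor (2 ^ m) (2 ^ m) (U L r m) (U L r m).
Proof. by move=> h; rewrite -had_layerE -cnot_gatesE /U -/(U L) ltnNge h. Qed.

Lemma expn2_half m : 2 ^ m.+1 = 2 ^ m + 2 ^ m.
Proof. by rewrite expnS mul2n addnn. Qed.

Lemma two_halves m : 2 ^ m + 2 ^ m <= 2 ^ m.+1.
Proof. by rewrite expn2_half. Qed.

Lemma layer_ready (T : eqType) (f k : T -> nat) (A : seq T) b d : uniq A ->
  {in A &, injective f} -> {in A &, injective k} ->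
  {in A, forall u, f u < b} -> {in A, forall u, k u < d} ->
  all (inside 0 (b + d)) (cnot_gates f (fun u => b + k u) A) /\
  disjoint_gates (cnot_gates f (fun u => b + k u) A).
Proof.
move=> uA finj kinj hf hk; split.
  by apply: cnot_gates_inside => u hu; have := hf _ hu; have := hk _ hu; lia.
apply: (cnot_gates_disjoint (b := b)) => // [u v hu hv /addnI|u hu]; first exact: kinj.
exact: leq_addr.
Qed.

Lemma Uc_layer_ready r m :
  all (inside 0 (2 ^ m.+1)) (Uc_layer r m) /\ disjoint_gates (Uc_layer r m).
Proof.
rewrite expn2_half; apply: layer_ready; [exact: uniq_G| | | |].
1,2: exact: Mc_inj.
all: by move=> u; apply: Mc_lt.
Qed.

Lemma U_layer_ready r m : r <= m ->
  all (inside 0 (2 ^ m.+1)) (U_layer r m) /\ disjoint_gates (U_layer r m).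
Proof.
move=> hr; rewrite expn2_half; apply: layer_ready; [exact: uniq_G3| | | |].
1,2: exact: MU_inj.
all: by move=> u; apply: MU_lt.
Qed.

Lemma wf_Uc r m : r <= m -> wf (2 ^ m) (Uc L r m).
Proof.
elim: m r => // m IH r hr; rewrite UcS; split.
  by case: (admissible_pc (ltn0Sn m) hr).
apply/wf_cat; split; first by apply/wf_gates; case: (Uc_layer_ready (minn r m) m).
by apply: wf_tensor; rewrite ?two_halves //; apply: IH; rewrite geq_minr.
Qed.

Lemma layerable_Uc r m : r <= m -> layerable (wire_gates (Uc L r m)) m.
Proof.
elim: m r => [|m IH] r hr; first exact: layerable_nil.
rewrite UcS /=; have [h1 h2] := Uc_layer_ready (minn r m) m.
have hm := geq_minr r m.
have hw := wf_Uc hm.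
apply: layerable_layer h1 h2 (wf_tensor (two_halves _) hw hw) _.
by apply: layerable_tensor => //; apply: IH.
Qed.

(** By Pascal's rule ['C(m, m - r)] is at most ['C(m.+1, m - r)], so the Hadamard qubits fit into
    the share of degree m - r, just below the summed degrees. *)
Lemma had_layer_U_bound r m : m <= 2 * r -> r <= m ->
  \sum_(m.+1 - r <= i < r.+1) 'C(m.+1, i) + 'C(m, m.+1 - r.+1) <= 2 ^ m.+1.
Proof.
move=> hm hr; apply: leq_trans (sum_binomial_le m.+1 (m - r) r.+1).
have h : m - r < r.+1 by lia.
rewrite subSS subSn // (big_ltn h) addnC leq_add2r; case: (m - r) => [|k].
  by rewrite !bin0.
by rewrite binS leq_addr.
Qed.

Lemma had_layer_ready k l n : k + l <= n ->
  all (inside 0 n) [seq Had i | i <- iota k l] /\ disjoint_gates [seq Had i | i <- iota k l].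
Proof. by move=> h; split; [exact: had_layer_inside | exact: had_layer_disjoint]. Qed.

Lemma wf_U r m : m.-1 <= 2 * r -> r <= m -> wf (2 ^ m) (U L r m).
Proof.
elim: m => [|m IH] hm hr; first by rewrite U_le //; apply: wf_Uc.
case: (leqP r m) => hrm; last by rewrite U_le //; apply: wf_Uc.
rewrite U_gt //; have [h1 _] := had_layer_ready (had_layer_U_bound hm hrm).
have [h2 _] := U_layer_ready hrm; have hw := IH (leq_trans (leq_pred _) hm) hrm.
apply/wf_cat; split; first exact/wf_gates.
split; first by case: (admissible_pU (ltn0Sn m) hm (hrm : r < m.+1)).
by apply/wf_cat; split; [exact/wf_gates | exact: (wf_tensor (two_halves _) hw hw)].
Qed.

(** One Hadamard layer and one CNOT layer per level; at the bottom stands [Uc], with a single layer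
    per level. *)
Lemma layerable_U r m : m.-1 <= 2 * r -> r <= m -> layerable (wire_gates (U L r m)) (2 * m).
Proof.
elim: m => [|m IH] hm hr; first by rewrite U_le //; apply: layerable_Uc.
case: (leqP r m) => hrm; last first.
  by rewrite U_le //; apply: layerable_le (layerable_Uc (leqnn _)); lia.
rewrite U_gt //; have [h1 d1] := had_layer_ready (had_layer_U_bound hm hrm).
have [h2 d2] := U_layer_ready hrm; have hm' := leq_trans (leq_pred _) hm.
have hw := wf_U hm' hrm; have hT := wf_tensor (two_halves m) hw hw.
rewrite mulnS; apply: layerable_layer h1 d1 _ _.
  split; first by case: (admissible_pU (ltn0Sn m) hm (hrm : r < m.+1)).
  by apply/wf_cat; split => //; apply/wf_gates.
apply: layerable_layer h2 d2 hT _.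
by apply: layerable_tensor => //; apply: IH.
Qed.

Lemma zetac_full m : zetac m m = m * 2 ^ m.-1.
Proof. by case: m => //= m; rewrite ltnn. Qed.

Lemma cnot_count_Uc r m : r <= m -> cnot_count (Uc L r m) = zetac r m.
Proof.
elim: m r => // m IH r hr.
rewrite UcS cnot_count_relabel cnot_count_cat -cnot_gatesE cnot_count_cnots cnot_count_tensor.
rewrite IH ?geq_minr // addnn -mul2n; case: (leqP r m) => h.
  by rewrite (size_G_sum adm) /= ltnS h.
rewrite (size_G_full adm) zetac_full /= ltnS leqNgt h /=.
by case: m {IH hr h} => [//|m]; rewrite expnS /= mulnCA mulSn; lia.
Qed.

Lemma cnot_count_U r m : m.-1 <= 2 * r -> r <= m -> cnot_count (U L r m) = zeta r m.
Proof.
elim: m => [|m IH] hm hr; first by rewrite U_le.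
case: (leqP r m) => hrm; last first.
  by rewrite U_le // cnot_count_Uc // zetac_full /= ltnS leqNgt hrm.
rewrite U_gt // cnot_count_cat -had_layerE cnot_count_had_layer cnot_count_relabel.
rewrite cnot_count_cat -cnot_gatesE cnot_count_cnots cnot_count_tensor.
by rewrite IH ?(leq_trans (leq_pred _) hm) // (size_G3 adm) //= ltnS hrm subSS addnn mul2n.
Qed.

(** * The wires of [Uc], in particular the last one *)

Lemma inside_wire_gates n c g : wf n c -> g \in wire_gates c -> inside 0 n g.
Proof. by move=> /wire_gates_inside /allP; apply. Qed.

(** The relabelings inside the two halves keep each half in place, so a control of the first layer
    still lies in the first half at the end. The clause [false] records that there are no Hadamard
    gates. *)
Lemma Uc_last_not_control r m : r <= m ->
  all (fun g => if g is Cnot i j then i != 2 ^ m - 1 else false) (wire_gates (Uc L r m)).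
Proof.
elim: m r => // m IH r hr; have hm := geq_minr r m; have hw := wf_Uc hm.
have h2 := expn2_half m; have h0 := expn_gt0 2 m.
rewrite UcS /= wire_gates_cat all_cat wire_gates_gates wire_gates_tensor // all_cat.
apply/and3P; split; rewrite ?all_map; apply/allP.
- move=> u /(Mc_lt adm) hu /=; rewrite track_tensor // hu.
  by have [tlt _] := permutes_track hw; have := tlt _ hu; lia.
- move=> g hg; have := allP (IH _ hm) _ hg; have := inside_wire_gates hw hg.
  by case: g {hg} => // i j /insideP /(_ i); rewrite inE eqxx; lia.
- move=> g hg; have /= := allP (IH _ hm) _ hg.
  by case: g {hg} => //= i j; lia.
Qed.

Lemma unit_last_cat m : zeros (2 ^ m) ++ unit_last (2 ^ m) = unit_last (2 ^ m.+1).
Proof.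
rewrite /unit_last -rcons_cat /zeros -nseqD; congr (rcons (nseq _ _) _).
by rewrite expn2_half; have := expn_gt0 2 m; lia.
Qed.

Lemma mem_unit_last m : unit_last (2 ^ m) \in G L m%:Z m.
Proof. by rewrite -eval_monomialT (mem_G_eval adm) lez_nat cardsT card_ord. Qed.

(** The monomial of full degree contains the first variable at every level, so its message is sent
    to the second half each time. *)
Lemma track_Uc_unit_last m : track (Uc L m m) (Mc L m m (unit_last (2 ^ m))) = 2 ^ m - 1.
Proof.
elim: m => [|m IH].
  have := Mc_lt adm (mem_unit_last 0); rewrite /= expn0.
  by case: (Mc L 0 0 _).
have [_ _ hv] := admissible_pc (ltn0Sn m) (leqnn m.+1); rewrite /= (minn_idPr (leqnSn m)) in hv.
rewrite UcS /= (minn_idPr (leqnSn m)) track_cat track_gates -unit_last_cat hv; last first.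
  have -> : (m.+1%:Z - 1 = m%:Z)%R by lia.
  exact: mem_unit_last.
have hw := wf_Uc (leqnn m); have hlt := Mc_lt adm (mem_unit_last m).
rewrite track_tensor // ltnNge leq_addr /= ltn_add2l hlt addKn IH.
by rewrite expn2_half; have := expn_gt0 2 m; lia.
Qed.

(* The message position of G(r+1, r+1) \ G(r, r+1) is the only one that no other row occupies. *)
Lemma track_Uc_last r : track (Uc L r r.+1) (2 ^ r.+1 - 1) = 2 ^ r.+1 - 1.
Proof.
have [pP pu pv] := admissible_pc (ltn0Sn r) (leqnSn r).
rewrite /= minnn in pu pv.
have hlt := Mc_lt adm (mem_unit_last r); have h0 := expn_gt0 2 r.
have hj : 2 ^ r + Mc L r r (unit_last (2 ^ r)) < 2 ^ r.+1 by rewrite expn2_half ltn_add2l.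
have [q hq pq] := permutes_surj pP hj.
(* [q] is the position sent to the top message of the second half. If a row [(u, u)] sat there, it
   would land in the first half; for a row [(0, v)], [v] would have full degree and the row itself
   degree r + 1. *)
have eq : q = 2 ^ r.+1 - 1.
  case: (ltnP q (2 ^ r.+1 - 1)) => hq'; last by lia.
  rewrite -(size_G_pred adm) in hq'; have := mem_nth [::] hq'.
  set g := nth _ _ _ => hg; have eqg : Mc L r r.+1 g = q by rewrite /Mc index_uniq ?uniq_G.
  have [S hS eg] := GP adm _ _ _ hg; have := card_tail_set S.
  move: eg; rewrite eval_monomial_rec; case: ifP => _ eg hc.
    have hv : eval_monomial (tail_set S) \in G L (r%:Z - 1)%R r.
      by rewrite (mem_G_eval adm); move: hS; rewrite hc lez_nat; lia.
    have := pv _ hv; rewrite -eg eqg pq => /addnI e.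
    have := index_injl (mem_unit_last r) e.
    rewrite -eval_monomialT => /eval_monomial_inj eT.
    by move: hS; rewrite hc -eT cardsT card_ord lez_nat; lia.
  have hu : eval_monomial (tail_set S) \in G L r%:Z r.
    by rewrite (mem_G_eval adm); move: hS; rewrite hc lez_nat.
  have := pu _ hu; rewrite -eg eqg pq => e.
  by have := Mc_lt adm hu; rewrite -e; lia.
rewrite UcS /= -eq pq minnn track_cat track_gates.
have hw := wf_Uc (leqnn r).
rewrite track_tensor // ltnNge leq_addr /= ltn_add2l hlt addKn track_Uc_unit_last.
by rewrite eq expn2_half; lia.
Qed.

Lemma track_Uc_pred_last r : track (Uc L r.-1 r) (2 ^ r - 1) = 2 ^ r - 1.
Proof. by case: r => // r; apply: track_Uc_last. Qed.

Lemma count_wire_map f i gs : count (fun g => i \in qubits g) gs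
  <= count (fun g => f i \in qubits g) (map (map_gate f) gs).
Proof. by rewrite count_map; apply: sub_count => g /=; rewrite qubits_map; apply: map_f. Qed.

(** For [r] at least m - 1 both halves encode the full space, so the CNOT gates of each level pair
    all qubits of the two halves: every wire is touched at every level. *)
Lemma Uc_wire_busy r m i : m <= r.+1 -> r <= m -> i < 2 ^ m ->
  m <= count (fun g => i \in qubits g) (wire_gates (Uc L r m)).
Proof.
elim: m r i => // m IH r i hmr hr hi.
have em : minn r m = m by apply/minn_idPr.
have hw := wf_Uc (leqnn m).
rewrite UcS em /= wire_gates_cat wire_gates_gates wire_gates_tensor //.
set T := track _.
have TP : permutes (2 ^ m.+1) T by apply: permutes_track; apply: (wf_tensor (two_halves m) hw hw).
have [j hj ej] := permutes_surj TP hi.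
have row k : k < 2 ^ m -> exists2 u, u \in G L m%:Z m & Mc L m m u = k.
  rewrite -(size_G_full adm) => hk; exists (nth [::] (G L m%:Z m) k); first exact: mem_nth.
  by rewrite /Mc index_uniq ?uniq_G.
rewrite count_cat -[m.+1]add1n; apply: leq_add.
  rewrite -ej; apply: leq_trans (count_wire_map T j _); rewrite -has_count has_map; apply/hasP.
  case: (ltnP j (2 ^ m)) => hj'.
    by have [u hu eu] := row _ hj'; exists u; rewrite //= !inE eu eqxx.
  have [u hu eu] := row (j - 2 ^ m) (ltac:(have := expn2_half m; lia)).
  by exists u; rewrite //= !inE eu subnKC // eqxx orbT.
move: ej; rewrite /T track_tensor // count_cat; have [tlt _] := permutes_track hw.
case: ltnP => hj'; first by move=> <-; apply: leq_trans (IH m _ _ _ (tlt _ hj')) (leq_addr _ _).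
have hk : j - 2 ^ m < 2 ^ m by have := expn2_half m; lia.
rewrite -expn2_half hj => <-; apply: leq_trans (leq_addl _ _).
by apply: leq_trans (count_wire_map _ _ _); apply: IH (tlt _ hk).
Qed.

End Encoders.

(** * The punctured encoders *)

Section Punctured.
Variables (L : layout) (adm : admissible L).

Definition Ustar_layer r m := cnot_gates (fun u => MS L r m (behead u))
  (fun u => 2 ^ m - 1 + MU L r m u) (G3 L r m.+1).

Definition Ustar_last_layer r := cnot_gates (fun u => MS L r r.+1 (behead u))
  (fun u => 2 ^ r.+1 - 1 + Mc L r r.+1 u) (G L r%:Z r.+1).

Lemma Ustar_first_gt r m : r < m -> Ustar_first L r m.+1 =
  map Gate [seq Had i |
      i <- iota (1 + \sum_(m.+1 - r <= i < r.+1) 'C(m.+1, i)) 'C(m, m.+1 - r.+1)]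
    ++ Relabel (pS L r m.+1) :: map Gate (Ustar_layer r m).
Proof. by move=> h; rewrite /Ustar_first h -had_layerE -cnot_gatesE. Qed.

Lemma Ustar_first_last r : Ustar_first L r.+1 r.+2 =
  Relabel (pS L r.+1 r.+2) :: map Gate (Ustar_last_layer r).
Proof.
rewrite /Ustar_first ltnn -cnot_gatesE /=.
by have -> : (r.+1%:Z - 1 = r%:Z)%R by lia.
Qed.

Definition front r := (Ustar_split L r r.+1).1.
(** Written out instead of projected from the split; at r = 0 it is the empty circuit, as in the
    split. *)
Definition back r := embed (2 ^ r - 1) (2 ^ r) (Uc L r.-1 r).

Lemma split_back r : (Ustar_split L r r.+1).2 = back r.
Proof.
case: r => // r; rewrite /= ltnn -/(Ustar_split L r r.+1).
by case: (Ustar_split L r r.+1).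
Qed.

Lemma Ustar_moved_last r : Ustar_moved L r r.+1 = front r ++ back r.
Proof. by rewrite /Ustar_moved split_back. Qed.

Lemma Ustar_moved_gt r m : r < m -> Ustar_moved L r m.+1 = Ustar_first L r m.+1
  ++ tensor (2 ^ m - 1) (2 ^ m) (Ustar_moved L r m) (U L r m).
Proof.
case: m => // m h; rewrite /Ustar_moved /= h -/(Ustar_split L r m.+1).
by case: (Ustar_split L r m.+1) => f b /=; rewrite cats0.
Qed.

Lemma UstarS_gt r m : r < m -> Ustar L r m.+1 = Ustar_first L r m.+1
  ++ tensor (2 ^ m - 1) (2 ^ m) (Ustar L r m) (U L r m).
Proof. by case: m => // m h; rewrite /= h. Qed.

Lemma UstarS_last r : Ustar L r.+1 r.+2 = Ustar_first L r.+1 r.+2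
  ++ embed 0 (2 ^ r.+1 - 1) (Ustar L r r.+1)
  ++ [:: Gate (Cnot (2 ^ r.+2 - 2) (2 ^ r.+1 - 2))] ++ back r.+1.
Proof. by rewrite [LHS]/= ltnn. Qed.

Lemma half_sum r : 2 ^ r - 1 + 2 ^ r = 2 ^ r.+1 - 1.
Proof. by rewrite expn2_half; have := expn_gt0 2 r; lia. Qed.

Lemma wf_Uc_pred r : wf (2 ^ r) (Uc L r.-1 r).
Proof. exact/(wf_Uc adm)/leq_pred. Qed.

Lemma wf_back r n : 2 ^ r.+1 - 1 <= n -> wf n (back r).
Proof. by rewrite -half_sum => h; apply: wf_embed h (wf_Uc_pred r). Qed.

Lemma embed_back r n : 2 ^ r.+1 - 1 <= n -> embed 0 n (back r) = back r.
Proof. by rewrite -half_sum => h; rewrite /back embed_embed. Qed.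

Lemma track_back_lt r i : i < 2 ^ r - 1 -> track (back r) i = i.
Proof.
move=> hi; rewrite track_embed; last exact: wf_Uc_pred.
by rewrite /embed_perm ifF //; lia.
Qed.

Lemma track_back_gt r i : 2 ^ r.+1 - 1 <= i -> track (back r) i = i.
Proof.
rewrite -half_sum => hi; rewrite track_embed; last exact: wf_Uc_pred.
by rewrite /embed_perm ifF //; lia.
Qed.

Lemma track_back_last r : track (back r) (2 ^ r.+1 - 2) = 2 ^ r.+1 - 2.
Proof.
have h0 := expn_gt0 2 r; rewrite track_embed; last exact: wf_Uc_pred.
rewrite /embed_perm ifT; last by rewrite expn2_half; lia.
have -> : 2 ^ r.+1 - 2 - (2 ^ r - 1) = 2 ^ r - 1 by rewrite expn2_half; lia.
by rewrite (track_Uc_pred_last adm) expn2_half; lia.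
Qed.

(** The index inverts the relabelings of the encoder that is jumped over. These fix the last wire,
    so the moved gate keeps its target. *)
Lemma moved_target r :
  index (2 ^ r.+1 - 2) (mkseq (track (back r)) (2 ^ r.+1 - 1)) = 2 ^ r.+1 - 2.
Proof.
have h0 := expn_gt0 2 r; have hlt : 2 ^ r.+1 - 2 < 2 ^ r.+1 - 1 by rewrite expn2_half; lia.
have [_ tinj] := permutes_track (wf_back (leqnn (2 ^ r.+1 - 1))).
rewrite -[X in index X]track_back_last -(nth_mkseq 0 _ hlt) index_uniq ?size_mkseq //.
rewrite map_inj_in_uniq ?iota_uniq // => i j; rewrite !mem_iota !add0n => hi hj.
exact: tinj.
Qed.

Definition moved_gate r := Cnot (2 ^ r.+2 - 2) (2 ^ r.+1 - 2).

Definition after_first r := embed 0 (2 ^ r.+1 - 1) (front r) ++ [:: Gate (moved_gate r)] ++ back r.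

Lemma frontS r : front r.+1 = Ustar_first L r.+1 r.+2 ++ after_first r.
Proof.
rewrite /front [Ustar_split L r.+1 r.+2]/= ltnn -/(Ustar_split L r r.+1) -/(Uc L r r.+1).
have := split_back r; have : (Ustar_split L r r.+1).1 = front r by [].
case: (Ustar_split L r r.+1) => f b /= -> ->.
by rewrite moved_target embed_back.
Qed.

Lemma Ustar_last_layer_ready r :
  all (inside 0 (2 ^ r.+2 - 1)) (Ustar_last_layer r) /\ disjoint_gates (Ustar_last_layer r).
Proof.
rewrite -half_sum; apply: layer_ready; [exact: uniq_G| | | |].
- exact: MS_last_inj.
- exact: Mc_inj.
- by move=> u; apply: MS_last_lt.
- by move=> u; apply: Mc_lt.
Qed.

Lemma Ustar_layer_ready r m : m <= 2 * r -> r < m ->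
  all (inside 0 (2 ^ m.+1 - 1)) (Ustar_layer r m) /\ disjoint_gates (Ustar_layer r m).
Proof.
move=> hm hr; have hr' := ltnW hr; rewrite -half_sum; apply: layer_ready; [exact: uniq_G3| | | |].
- exact: MS_inj.
- exact: MU_inj.
- by move=> u; apply: MS_lt.
- by move=> u; apply: MU_lt.
Qed.

Lemma wf_Ustar_first_last r : wf (2 ^ r.+2 - 1) (Ustar_first L r.+1 r.+2).
Proof.
rewrite Ustar_first_last; split; first by case: (admissible_pS_last adm (ltn0Sn r)).
by apply/wf_gates; case: (Ustar_last_layer_ready r).
Qed.

Lemma wf_moved_gate r : inside 0 (2 ^ r.+2 - 1) (moved_gate r).
Proof.
have h0 := expn_gt0 2 r; have := expn2_half r; have := expn2_half r.+1 => h1 h2.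
by apply/insideP => i; rewrite !inE => /orP[] /eqP ->; lia.
Qed.

Lemma block_le r : 2 ^ r.+1 - 1 <= 2 ^ r.+2 - 1.
Proof. by rewrite (expn2_half r.+1) leq_sub2r ?leq_addr. Qed.

Lemma wf_after_first r : wf (2 ^ r.+1 - 1) (front r) -> wf (2 ^ r.+2 - 1) (after_first r).
Proof.
move=> h; apply/wf_cat; split; first by apply: wf_embed h; exact: block_le.
by split; [exact: wf_moved_gate | apply: wf_back; exact: block_le].
Qed.

Lemma wf_front r : wf (2 ^ r.+1 - 1) (front r).
Proof.
elim: r => // r IH; rewrite frontS; apply/wf_cat; split; first exact: wf_Ustar_first_last.
exact: wf_after_first.
Qed.

Lemma wire_gates_front r : wire_gates (front r.+1) =
  map (map_gate (track (after_first r))) (Ustar_last_layer r)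
  ++ map (map_gate (track (back r))) (wire_gates (front r))
  ++ moved_gate r :: wire_gates (back r).
Proof.
rewrite frontS Ustar_first_last wire_gates_cat /= wire_gates_gates wire_gates_cat /=.
rewrite wire_gates_embed0; last exact: wf_front.
(* The encoder that follows fixes both wires of the moved gate: the target is the last qubit of its
   block and the control lies beyond it. *)
congr (_ ++ _ ++ _ :: _); rewrite /= track_back_last track_back_gt //.
have h0 := expn_gt0 2 r; have := expn2_half r; have := expn2_half r.+1; lia.
Qed.

(** * Upper bound [3 * r] on the depth *)

Lemma back_inside r : all (inside (2 ^ r - 1) (2 ^ r.+1 - 1)) (wire_gates (back r)).
Proof. by rewrite -half_sum; apply: wire_gates_embed_inside; apply: wf_Uc_pred. Qed.

Lemma layerable_back r : layerable (wire_gates (back r)) r.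
Proof.
rewrite wire_gates_embed; last exact: wf_Uc_pred.
apply: layerable_map (wire_gates_inside (wf_Uc_pred r)) (layerable_Uc adm (leq_pred r)).
by move=> i j _ _ /addnI.
Qed.

(** With [a = 2 ^ r - 1], the first qubit of [back r], these are the gates of [front r] for which
    [back r] may have to wait. *)
Definition reaches a (g : gate) := has (leq a) (qubits g).

Lemma reaches_back r g : reaches (2 ^ r - 1) (map_gate (track (back r)) g) -> reaches (2 ^ r - 1) g.
Proof.
case/hasP => i; rewrite qubits_map => /mapP[j hj ->] h; apply/hasP; exists j => //.
by case: leqP => // hlt; rewrite track_back_lt // leqNgt hlt in h.
Qed.

(** The last clause makes [3 * r] inductive: whatever the next encoder waits for is over before
    layer [2 * r]. At level r + 1 only the first stage, in layer 0, and the moved gate, in layer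
    [2 * r + 1], reach the new second half. *)
Lemma front_schedule r : exists ts,
  [/\ unzip1 ts = wire_gates (front r), all (fun t => t.2 < 3 * r) ts, pairwise compat ts
    & all (fun t => reaches (2 ^ r - 1) t.1 ==> (t.2 < 2 * r)) ts].
Proof.
elim: r => [|r [ts [ets dts pts rts]]]; first by exists [::].
have [tb [etb dtb ptb]] := layerable_back r.
set n := 2 ^ r.+1 - 1; set T := track (back r).
have h0 := expn_gt0 2 r; have h1 := expn2_half r; have h2 := expn2_half r.+1.
have wfB := wf_back (leqnn n); have [tlt tinj] := permutes_track wfB.
have wfA := wf_after_first (wf_front r); have [_ ainj] := permutes_track wfA.
have [lin ldis] := Ustar_last_layer_ready r.
have tsin t : t \in ts -> inside 0 n t.1.
  by move=> ht; apply: (inside_wire_gates (wf_front r)); rewrite -ets; apply: map_f.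
have tbin t : t \in tb -> inside (2 ^ r - 1) n t.1.
  by move=> ht; apply: (allP (back_inside r)); rewrite -etb; apply: map_f.
have early t : t \in ts -> reaches (2 ^ r - 1) (map_gate T t.1) -> t.2 < 2 * r.
  by move=> ht /reaches_back; apply: (implyP (allP rts _ ht)).
(* The inner front is delayed by 1, so its gates that meet the moved one or [back r] end by layer
   [2 * r]. The moved gate takes the next layer and [back r] the [r] layers after it. *)
exists (at_start (map (map_gate (track (after_first r))) (Ustar_last_layer r))
  ++ delay 1 (move_gates T ts) ++ (moved_gate r, (2 * r).+1) :: delay (2 * r).+2 tb); split.
- by rewrite wire_gates_front !unzip1_cat /= unzip1_at_start !unzip1_delay unzip1_move ets etb.
- rewrite !all_cat /= !all_map; apply/and4P; split; try apply/allP => t ht /=; try lia.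
  + by have := allP dts _ ht => /=; lia.
  + by have := allP dtb _ ht => /=; lia.
- rewrite !pairwise_cat /= !pairwise_delay (pairwise_move tinj) ?ets ?wire_gates_inside //; last first.
    exact: wf_front.
  rewrite pts ptb pairwise_at_start ?(disjoint_gates_map ainj) // !andbT /=.
  apply/and3P; split.
  + apply/allrelP => _ t /mapP[g _ ->] ht; rewrite /compat /=; apply/implyP => _.
    move: ht; rewrite mem_cat inE => /or3P[/mapP[u _ ->]|/eqP ->|/mapP[u _ ->]] //.
  (* An inner gate stays below [n], so it can meet the moved gate only at its target, the last qubit
     of the block. In either case it reaches the block of [back r]. *)
  + apply/allrelP => _ t /mapP[_ /mapP[u hu ->] ->] ht; rewrite /compat /=; apply/implyP => ho.
    have hr : reaches (2 ^ r - 1) (map_gate T u.1).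
      case/overlapP: ho => i hi ht'; apply/hasP; exists i => //.
      have hin : i < n.
        by move: hi; rewrite qubits_map => /mapP[j /(insideP (tsin _ hu)) hj ->]; apply: tlt.
      move: ht; rewrite inE => /orP[/eqP e|/mapP[v hv e]]; rewrite e /= in ht'.
        by move: ht'; rewrite !inE /n in hin * => /orP[]/eqP e'; lia.
      by have /insideP /(_ _ ht') /andP[] := tbin _ hv.
    have := early _ hu hr.
    by move: ht; rewrite inE => /orP[/eqP ->|/mapP[v _ ->]] /=; lia.
  + by apply/allP => _ /mapP[v _ ->]; rewrite /compat /=; apply/implyP; lia.
- rewrite !all_cat /= !all_map; apply/and4P; split; try apply/allP => t ht /=.
  + by apply/implyP; lia.
  + apply/implyP => /hasP[i]; rewrite qubits_map => /mapP[j /(insideP (tsin _ ht)) hj ->].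
    by have := tlt j hj; rewrite /T /n; lia.
  + by apply/implyP; lia.
  + by apply/implyP => /hasP[i] /(insideP (tbin _ ht)); rewrite /n; lia.
Qed.

Lemma layerable_Ustar_last r : layerable (wire_gates (Ustar_moved L r r.+1)) (3 * r).
Proof.
have [ts [ets dts pts rts]] := front_schedule r.
have [tb [etb dtb ptb]] := layerable_back r.
set n := 2 ^ r.+1 - 1; set T := track (back r).
have wfB := wf_back (leqnn n); have [tlt tinj] := permutes_track wfB.
(* By the invariant [back r] may start at layer [2 * r], while the rest of the front is still
   running. *)
exists (move_gates T ts ++ delay (2 * r) tb); split.
- by rewrite Ustar_moved_last wire_gates_cat unzip1_cat unzip1_move unzip1_delay ets etb.
- rewrite all_cat !all_map; apply/andP; split => //; apply/allP => t ht /=.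
  by have := allP dtb _ ht => /=; lia.
rewrite pairwise_cat pairwise_delay ptb (pairwise_move tinj) ?ets ?wire_gates_inside ?pts //; last first.
  exact: wf_front.
rewrite !andbT; apply/allrelP => _ _ /mapP[u hu ->] /mapP[v hv ->].
rewrite /compat /=; apply/implyP => /overlapP[i hi hv'].
have hr : reaches (2 ^ r - 1) (map_gate T u.1).
  apply/hasP; exists i => //.
  have /insideP /(_ _ hv') /andP[] // : inside (2 ^ r - 1) n v.1.
  by apply: (allP (back_inside r)); rewrite -etb; apply: map_f.
by have := implyP (allP rts _ hu) (reaches_back hr); lia.
Qed.

(** * Lower bound [3 * r] on the depth *)

Lemma sorted_overlap_map f s : sorted overlap s -> sorted overlap (map (map_gate f) s).
Proof. by apply: homo_sorted => g h; apply: overlap_map. Qed.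

(* The chain of length 2r that the last wire of a block closes: the CNOT layers of the r first
   stages, followed by the r moved gates, each of which has its target on the control of the
   previous one. *)
Lemma sorted_rcons2 (T : Type) (e : rel T) s x y :
  sorted e (rcons (rcons s x) y) = sorted e (rcons s x) && e x y.
Proof. by case: s => [|z s] /=; rewrite ?andbT // rcons_path last_rcons. Qed.

(** The end is left open: any gate on the last wire may be appended. In the induction this is the
    next moved gate, which has its target there; for the lower bound, a gate of the closing
    encoder. *)
Lemma front_chain r : exists cs,
  [/\ subseq cs (wire_gates (front r)), size cs = 2 * r
    & forall h, 2 ^ r.+1 - 2 \in qubits h -> sorted overlap (rcons cs h)].
Proof.
elim: r => [|r [cs [scs ncs chain]]]; first by exists [::].
set n := 2 ^ r.+1 - 1; set T := track (back r).
have h0 := expn_gt0 2 r; have h1 := expn2_half r; have h2 := expn2_half r.+1.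
have hd : 2 ^ r.+1 - 2 \in qubits (moved_gate r) by rewrite !inE eqxx orbT.
pose tl := rcons (map (map_gate T) cs) (moved_gate r).
have stl : sorted overlap tl.
  have := sorted_overlap_map T (chain _ hd); rewrite map_rcons.
  by rewrite /= /T track_back_last track_back_gt //; lia.
(* The first gate of the tail has a wire [i] in the inner block; if [cs] is empty, that gate is the
   moved one and [i] its target. A gate of the new first stage that ends on [i] will prolong the
   chain to the left. *)
have [i hi hin] : exists2 i, i \in qubits (head (moved_gate r) tl) & i < n.
  rewrite /tl; case: cs scs {ncs chain tl stl} => [|g cs'] hs /=.
    by exists (2 ^ r.+1 - 2); rewrite // /n; lia.
  have /(inside_wire_gates (wf_front r)) : g \in wire_gates (front r).
    by apply: (mem_subseq hs); rewrite inE eqxx.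
  have [tlt _] := permutes_track (wf_back (leqnn n)).
  case: g {hs} => [j|j k] /insideP /(_ j); rewrite inE eqxx => /(_ isT) hj;
    by exists (T j); rewrite ?inE ?eqxx //; apply: tlt.
have wfA := wf_after_first (wf_front r).
have wfN : wf n (embed 0 n (front r)) by apply: wf_embed (wf_front r).
(* The moved gate acts beyond the first [n] positions but relabels nothing, so wire [i] comes from
   one of these positions, which is a control of the first stage. *)
have PA : permutes n (track (after_first r)).
  rewrite /after_first.
  have -> : track (embed 0 n (front r) ++ [:: Gate (moved_gate r)] ++ back r)
      = track (embed 0 n (front r) ++ back r).
    by apply: functional_extensionality => j; rewrite !track_cat.
  by apply/permutes_track/wf_cat; split => //; apply: wf_back.
have [j hj ej] := permutes_surj PA hin.
have [u hu eu] := MS_last_surj adm hj.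
pose g := map_gate (track (after_first r))
  (Cnot (MS L r r.+1 (behead u)) (2 ^ r.+1 - 1 + Mc L r r.+1 u)).
exists (g :: tl); split.
- rewrite wire_gates_front -cat1s; apply: cat_subseq.
    by rewrite sub1seq; apply/map_f/map_f.
  rewrite /tl -cats1; apply: cat_subseq; first exact: map_subseq.
  by rewrite sub1seq inE eqxx.
- by rewrite /= size_rcons size_map ncs; lia.
move=> h hh; have dh : overlap (moved_gate r) h.
  by apply/overlapP; exists (2 ^ r.+2 - 2); rewrite // inE eqxx.
have : sorted overlap (rcons tl h) by rewrite /tl sorted_rcons2 dh andbT.
have gi : i \in qubits g by rewrite /g /= inE eu ej eqxx.
have ntl : 0 < size tl by rewrite size_rcons.
rewrite rcons_cons /=; move: hi ntl; move: (tl) => [|x s] //= hi _ ->; rewrite andbT.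
by apply/overlapP; exists i.
Qed.

Lemma Ustar_last_depth_ge r d :
  layerable (wire_gates (Ustar_moved L r r.+1)) d -> 3 * r <= d.
Proof.
have [cs [scs ncs chain]] := front_chain r.
set q := 2 ^ r.+1 - 2; have h0 := expn_gt0 2 r; have h1 := expn2_half r.
(* The closing encoder acts at least [r] times on its last wire [q], and gates sharing a wire form a
   chain. *)
pose bs := [seq g <- wire_gates (back r) | q \in qubits g].
have nbs : r <= size bs.
  rewrite size_filter wire_gates_embed; last exact: wf_Uc_pred.
  have -> : q = 2 ^ r - 1 + (2 ^ r - 1) by rewrite /q; lia.
  by apply: leq_trans (count_wire_map _ _ _); apply: (Uc_wire_busy adm); lia.
have sb : subseq (map (map_gate (track (back r))) cs ++ bs) (wire_gates (Ustar_moved L r r.+1)).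
  rewrite Ustar_moved_last wire_gates_cat; apply: cat_subseq; first exact: map_subseq.
  exact: filter_subseq.
move=> hd; have := chain_leq_depth sb _ hd; rewrite size_cat size_map ncs => hle.
suff hs : sorted overlap (map (map_gate (track (back r))) cs ++ bs).
  by apply: leq_trans (hle hs); rewrite (mulnDl 2 1) mul1n leq_add2l.
have ball : all (fun g => q \in qubits g) bs by apply: filter_all.
have sq : sorted overlap bs.
  case: bs ball {nbs sb hle} => //= g bs /andP[gq]; elim: bs g gq => //= h bs IH g gq /andP[hq ha].
  by rewrite IH // andbT; apply/overlapP; exists q.
(* [Had q] is only a probe: overlapping with it means acting on wire [q], so the last gate of [cs],
   renamed, overlaps the first gate of [bs]. *)
case: bs ball sq {nbs sb hle} => [_ _|g bs /= /andP[gq _] sq].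
  have := chain (Had q); rewrite inE eqxx => /(_ isT).
  rewrite cats0 => /(sorted_overlap_map (track (back r))).
  by rewrite map_rcons -cats1 => /cat_sorted2 [].
have := chain (Had q); rewrite inE eqxx => /(_ isT) /(sorted_overlap_map (track (back r))).
rewrite map_rcons /= track_back_last; case: (map _ cs) => //= x s.
rewrite rcons_path cat_path /= => /andP[-> ho] /=; rewrite sq andbT.
by case/overlapP: ho => i h; rewrite !inE => /eqP e; subst i; apply/overlapP; exists q.
Qed.

Lemma has_depth_Ustar_last r : has_depth (Ustar_moved L r r.+1) (3 * r).
Proof. by apply: has_depthP; [exact: layerable_Ustar_last | exact: Ustar_last_depth_ge]. Qed.

(** * Depth and number of CNOT gates for general [m] *)

Lemma had_layer_Ustar_bound r m : m <= 2 * r -> r < m ->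
  1 + \sum_(m.+1 - r <= i < r.+1) 'C(m.+1, i) + 'C(m, m.+1 - r.+1) <= 2 ^ m.+1 - 1.
Proof.
(* Degree 0 pays for the leading 1 and degree m + 1 for the punctured qubit; ['C(m, m - r)] is
   absorbed by degree m - r, which is positive and just below the summed range. *)
move=> hm hr; have := sum_binomial_le m.+1 0 m.+2.
rewrite (@big_cat_nat _ _ _ (m - r) 0 m.+2) //=; try lia.
rewrite (@big_cat_nat _ _ _ r.+1 (m - r) m.+2) //=; try lia.
rewrite (@big_ltn _ _ _ 0 (m - r)); last lia.
rewrite (@big_ltn _ _ _ (m - r) r.+1); last lia.
rewrite (@big_nat_recr _ _ _ m.+1 r.+1) /=; last lia.
rewrite subSS subSn ?(ltnW hr) // bin0 binn.
have : 'C(m, m - r) <= 'C(m.+1, m - r).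
  by case: (m - r) => [|k]; rewrite ?bin0 // binS leq_addr.
lia.
Qed.

(** Each level above m = r + 1 adds a Hadamard layer and a CNOT layer. The bound dominates both the
    [3 * r] layers at the bottom and the [2 * m] layers of the factor [U] running in parallel. *)
Lemma wf_layerable_Ustar r m : 0 < m -> m.-1 <= 2 * r -> r < m ->
  wf (2 ^ m - 1) (Ustar_moved L r m) /\
  layerable (wire_gates (Ustar_moved L r m)) (2 * (m + 2 * r)).
Proof.
elim: m => // m IH _ /= hm hr; case: (ltnP r m) => hrm; last first.
  have -> : m = r by lia.
  split; last by apply: layerable_le (layerable_Ustar_last r); lia.
  by rewrite Ustar_moved_last; apply/wf_cat; split; [exact: wf_front | apply: wf_back].
have [wM lM] := IH (leq_ltn_trans (leq0n r) hrm) (leq_trans (leq_pred m) hm) hrm.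
have wU := wf_U adm (leq_trans (leq_pred m) hm) (ltnW hrm).
have lU := layerable_U adm (leq_trans (leq_pred m) hm) (ltnW hrm).
rewrite Ustar_moved_gt // Ustar_first_gt // -catA cat_cons.
have [hin hdis] := had_layer_ready (had_layer_Ustar_bound hm hrm).
have [lin ldis] := Ustar_layer_ready hm hrm.
have wT : wf (2 ^ m.+1 - 1) (tensor (2 ^ m - 1) (2 ^ m) (Ustar_moved L r m) (U L r m)).
  by apply: wf_tensor => //; rewrite half_sum.
have wR : wf (2 ^ m.+1 - 1) (map Gate (Ustar_layer r m) ++
    tensor (2 ^ m - 1) (2 ^ m) (Ustar_moved L r m) (U L r m)).
  by apply/wf_cat; split => //; apply/wf_gates.
have [pS _ _] := admissible_pS adm (hm : m.+1.-1 <= _) (hrm : r.+1 < m.+1).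
split; first by apply/wf_cat; split => //; apply/wf_gates.
have le2 : 2 * m <= 2 * (m + 2 * r) by rewrite leq_mul2l leq_addr.
have lT := layerable_tensor wM wU lM (layerable_le le2 lU).
rewrite addSn mulnS; apply: layerable_layer hin hdis _ _; first by split.
exact: layerable_layer lin ldis wT lT.
Qed.

Lemma zetas_gt r m : r < m ->
  zetas r m.+1 = \sum_(m - r <= i < r.+1) 'C(m, i) + zetas r m + zeta r m.
Proof. by case: m => // m h; rewrite -subSS {1}/zetas h. Qed.

Lemma cnot_count_Ustar r m : 0 < m -> m.-1 <= 2 * r -> r < m ->
  cnot_count (Ustar L r m) = zetas r m.
Proof.
elim: m r => // m IH r _ hm hr; rewrite /= in hm; case: (ltnP r m) => hrm; last first.
  have em : m = r by lia.
  subst m; case: r => [//|r] in IH hm hr hrm *.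
  rewrite UstarS_last Ustar_first_last cnot_count_relabel !cnot_count_cat !cnot_count_embed.
  rewrite -cnot_gatesE cnot_count_cnots (size_G_pred adm) IH //; last by rewrite /=; lia.
  rewrite (cnot_count_Uc adm) // [zetas _ r.+2]/= ltnn /cnot_count /= -/(zetas r r.+1).
  (* The [2 ^ r.+1 - 1] gates of step (b) and the one of step (d) make up the term [2 ^ r.+1]. *)
  by have := expn_gt0 2 r.+1; lia.
rewrite UstarS_gt // Ustar_first_gt // cnot_count_cat cnot_count_tensor cnot_count_cat.
rewrite -had_layerE cnot_count_had_layer cnot_count_relabel -cnot_gatesE cnot_count_cnots.
rewrite IH ?(leq_trans (leq_pred _) hm) //; last exact: leq_ltn_trans hrm.
rewrite (cnot_count_U adm) ?(leq_trans (leq_pred _) hm) ?(ltnW hrm) //.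
rewrite (size_G3 adm) ?(ltnW hrm) // add0n addnA.
by rewrite zetas_gt.
Qed.

End Punctured.

(** * Moving the gates of step (d) *)

Lemma nth_set_bit n (x : n.-tuple bool) i b k :
  nth false (set_bit x i b) k = if (k == i) && (k < n) then b else nth false x k.
Proof.
case: (ltnP k n) => hk; last by rewrite andbF !nth_default ?size_tuple.
rewrite andbT -(tnth_nth false _ (Ordinal hk)) tnth_mktuple /=.
by case: ifP => // _; rewrite (tnth_nth false).
Qed.

Lemma tuple_eqP n (x y : n.-tuple bool) :
  (forall k, k < n -> nth false x k = nth false y k) -> x = y.
Proof. by move=> h; apply: eq_from_tnth => i; rewrite !(tnth_nth false) h. Qed.

Lemma nth_relabel n (x : n.-tuple bool) p k : k < n ->
  nth false [tuple nth false x (p (val i)) | i < n] k = nth false x (p k).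
Proof. by move=> hk; rewrite -(tnth_nth false _ (Ordinal hk)) tnth_mktuple. Qed.

Section Runs.
Variable C : numClosedFieldType.

Lemma run_cat n c1 c2 (psi : state C n) : run (c1 ++ c2) psi = run c2 (run c1 psi).
Proof. exact: foldl_cat. Qed.

Lemma run_embed0 n c (psi : state C n) : run (embed 0 n c) psi = run c psi.
Proof.
elim: c psi => //= o c IH psi; rewrite IH; congr run.
case: o => [[i|i j]|p] //=; apply: functional_extensionality => x; congr psi.
apply: tuple_eqP => k hk; rewrite (nth_relabel _ (embed_perm 0 n p)) // nth_relabel //.
by rewrite /embed_perm hk subn0.
Qed.

Lemma act_cnot_cnot n (psi : state C n) c w i j : c <> w -> i <> w -> j <> c ->
  act (act psi (Gate (Cnot c w))) (Gate (Cnot i j)) =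
  act (act psi (Gate (Cnot i j))) (Gate (Cnot c w)).
Proof.
move=> hcw hiw hjc; apply: functional_extensionality => x /=; congr psi.
apply: tuple_eqP => k hk; rewrite !nth_set_bit hk !andbT.
have [iw cj wc] : [/\ (i == w) = false, (c == j) = false & (c == w) = false].
  by split; apply/eqP => // e; apply: hjc.
have [wi jc] : (w == i) = false /\ (j == c) = false by rewrite !(eq_sym _ i) !(eq_sym j) iw cj.
rewrite iw cj /=; case: (eqVneq k w) => [ek|nk]; case: (eqVneq w j) => [e|nj] //=.
- by rewrite -e -ek hk eqxx addbAC.
- by rewrite ek (negbTE nj).
- by rewrite -e (negbTE nk).
Qed.

Lemma act_cnot_relabel n (psi : state C n) c w p : permutes n p -> w < n -> c < n ->
  act (act psi (Gate (Cnot c w))) (Relabel p) =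
  act (act psi (Relabel p)) (Gate (Cnot (p c) (p w))).
Proof.
move=> [plt pinj] hw hc; apply: functional_extensionality => x; rewrite /act; congr psi.
apply: tuple_eqP => k hk; rewrite nth_set_bit !nth_relabel // nth_set_bit plt // hk !andbT.
by rewrite (inj_in_eq pinj).
Qed.

(** The gate slides past one operation at a time: a relabeling renames its qubits, and a CNOT
    commutes with it because neither has its target on the control of the other. Stated on final
    wires, this condition is unaffected by the relabelings on the way. *)
Lemma run_jump n circ c w (psi : state C n) : wf n circ -> c < n -> w < n -> c <> w ->
  all (fun g => if g is Cnot i j then (i != track circ w) && (j != track circ c) else false)
    (wire_gates circ) ->
  run (Gate (Cnot c w) :: circ) psi =
  run (circ ++ [:: Gate (Cnot (track circ c) (track circ w))]) psi.
Proof.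
elim: circ c w psi => [//|[[i|i j]|p] circ IH] c w psi [h1 h2] hc hw hcw /=.
- by [].
- case/andP => /andP[hi hj] hall.
  rewrite act_cnot_cnot //; try by move=> e; move: hi hj; rewrite e eqxx.
  exact: IH.
- move=> hall; have [plt pinj] := h1.
  rewrite act_cnot_relabel //; apply: (IH (p c) (p w)) => //; try exact: plt.
  by move/pinj => e; apply: hcw; apply: e.
Qed.

Variables (L : layout) (adm : admissible L).

Lemma back_last_not_control r c : 2 ^ r.+1 - 1 <= c ->
  all (fun g => if g is Cnot i j then (i != 2 ^ r.+1 - 2) && (j != c) else false)
    (wire_gates (back L r)).
Proof.
move=> hc; have h1 := expn2_half r; have h0 := expn_gt0 2 r.
rewrite wire_gates_embed; last exact: wf_Uc_pred.
rewrite all_map; apply/allP => g hg; have hin := inside_wire_gates (wf_Uc_pred adm r) hg.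
have := allP (Uc_last_not_control adm (leq_pred r)) _ hg.
case: g {hg} hin => // i j /insideP hin /= hi.
by have := hin i; have := hin j; rewrite !inE !eqxx orbT => /(_ isT) hj /(_ isT) hi'; lia.
Qed.

(** [n] may exceed [2 ^ m - 1] because the induction hypothesis is applied to an encoder nested in a
    larger circuit, acting on the state of the whole. *)
Lemma run_moved r m n (psi : state C n) : 0 < m -> m.-1 <= 2 * r -> r < m -> 2 ^ m - 1 <= n ->
  run (embed 0 (2 ^ m - 1) (Ustar_moved L r m)) psi = run (embed 0 (2 ^ m - 1) (Ustar L r m)) psi.
Proof.
elim: m r psi => // m IH r psi _ hm hr hn; rewrite /= in hm.
have hmn : 2 ^ m - 1 <= 2 ^ m.+1 - 1 by rewrite leq_sub2r // leq_exp2l.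
case: (ltnP r m) => hrm; last first.
  have em : m = r by lia.
  subst m; case: r => [//|r] in IH hm hr hrm hn hmn *.
  have h0 := expn_gt0 2 r; have h1 := expn2_half r; have h2 := expn2_half r.+1.
  rewrite (Ustar_moved_last L) (frontS adm) UstarS_last /after_first -!catA !embed_cat !run_cat.
  rewrite embed_embed ?add0n; last exact: hmn.
  rewrite embed_embed ?add0n; last exact: hmn.
  congr (run _ _); rewrite (embed_back L); last exact: hmn.
  rewrite -IH; [|by []|by rewrite /=; lia|by []|exact: leq_trans hmn hn].
  rewrite (Ustar_moved_last L) embed_cat run_cat (embed_back L) //.
  set phi := run (embed 0 _ (front L r)) _.
  have c_ge : 2 ^ r.+1 - 1 <= 2 ^ r.+2 - 2 by lia.
  (* Both sides now start from [phi]; what remains is the jump of the gate of step (d) over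
     [back r]. *)
  have jump := @run_jump n (back L r) (2 ^ r.+2 - 2) (2 ^ r.+1 - 2) phi.
  rewrite (track_back_last adm) (track_back_gt adm) // run_cat in jump.
  apply: jump; [by apply: (wf_back adm); lia | by lia | by lia | by lia |].
  exact: back_last_not_control.
rewrite Ustar_moved_gt // UstarS_gt // !(embed_cat _ _ (Ustar_first _ _ _)) /tensor.
rewrite !(embed_cat _ _ (embed 0 _ _)) !run_cat !embed_embed ?half_sum ?add0n //.
by congr (run _ _); apply: IH => //; lia.
Qed.

End Runs.

Theorem mainTheorem6 :
  (* (i) *)
  (forall L : layout, admissible L ->
     [/\ forall r m : nat, 0 < m -> m.-1 <= 2 * r -> r < m ->
           cnot_count (Ustar L r m) = zetas r m,
         forall r m : nat, m.-1 <= 2 * r -> r <= m ->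
           cnot_count (U L r m) = zeta r m
       & forall r m : nat, r <= m -> cnot_count (Uc L r m) = zetac r m]) /\
  (* (ii): moving the gates does not change the operation performed, ... *)
  (forall (C : numClosedFieldType) (L : layout), admissible L ->
     forall r m : nat, 0 < m -> m.-1 <= 2 * r -> r < m ->
     forall (psi : state C (2 ^ m - 1)) (x : (2 ^ m - 1).-tuple bool),
       run (Ustar_moved L r m) psi x = run (Ustar L r m) psi x) /\
  (* ... the depth is 3r for m = r + 1, ... *)
  (forall L : layout, admissible L ->
     forall r : nat, has_depth (Ustar_moved L r r.+1) (3 * r)) /\
  (* ... and O(m + 2r) = O(log n) in general, where n = 2^m - 1 (log 1 = 0 is
     excluded; the base and the rounding of the logarithm only affect K). *)
  (exists K : nat,
     (forall L : layout, admissible L ->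
        forall r m : nat, 0 < m -> m.-1 <= 2 * r -> r < m ->
        exists2 d : nat, has_depth (Ustar_moved L r m) d & d <= K * (m + 2 * r)) /\
     (forall r m : nat, 1 < m -> m.-1 <= 2 * r -> r < m ->
        m + 2 * r <= K * trunc_log 2 (2 ^ m - 1))).
Proof.
split; [|split; [|split]].
- move=> L adm; split => r m.
  + exact: cnot_count_Ustar.
  + exact: cnot_count_U.
  + exact: cnot_count_Uc.
- move=> C L adm r m m0 hm hr psi x.
  by rewrite -(run_embed0 (Ustar_moved L r m)) (run_moved adm) // run_embed0.
- by move=> L adm r; apply: has_depth_Ustar_last.
(* The depth bound would allow 2; the logarithm is m - 1, and m + 2r <= 3m - 2 <= 4(m - 1) for m >=
   2, with equality at m = 2, r = 1. *)
exists 4; split => [L adm r m m0 hm hr|r m m1 hm hr].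
  have [_ /layerable_has_depth[d hd le_d]] := wf_layerable_Ustar adm m0 hm hr.
  by exists d => //; apply: leq_trans le_d _; rewrite leq_mul2r orbT.
have -> : trunc_log 2 (2 ^ m - 1) = m.-1.
  case: m m1 {hm hr} => // m m1; apply: trunc_log_eq => //.
  by rewrite expn2_half /=; have := expn_gt0 2 m; lia.
lia.
Qed.
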